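(* For $n\ge 2$ let $\rho(n)$ be the supremum of the ratio $\mathcal D/\mathcal L$ over all sets $S$ of $n$ pairwise interior disjoint $x$-monotone curves in general position and all insertion orders of $S$, where $\mathcal D$ is the depth and $\mathcal L$ the maximum query path length of the resulting history DAG $\mathbb G$. Then $\rho(n)=\Theta(n/\log n)$; that is, the worst-case lower bound $\Omega(n/\log n)$ on $\mathcal D/\mathcal L$ is attained and it is tight.
   Context: General position: no two distinct endpoints of curves have the same $x$-coordinate and no endpoint of one curve lies in the interior of another curve (curves may share endpoints). The trapezoidal map $\mathcal T(S)$ is obtained by extending a vertical wall from each endpoint upwards and downwards until it hits a curve of $S$ or goes to infinity; its faces are called trapezoids, considered open; each has at most one top curve, at most one bottom curve, and at most two vertical walls. History DAG $\mathbb G$ for an insertion order $cv_1,\dots,cv_n$ of $S$, with $S_i=\{cv_1,\dots,cv_i\}$: $\mathbb G_0$ is a single leaf (the whole plane). The leaves of $\mathbb G_i$ are the trapezoids of $\mathcal T(S_i)$. To pass from $\mathbb G_{i-1}$ to $\mathbb G_i$, let $p_i,q_i$ be the left and right endpoints of $cv_i$. Each leaf whose open trapezoid $\Delta$ is intersected by $cv_i$ is replaced by the following nodes, from top to bottom: if $p_i\in\Delta$, a point node $p_i$ whose left child is the leaf for the part of $\Delta$ left of $p_i$, and whose right child is the rest; then, if $q_i\in\Delta$, a point node $q_i$ whose right child is the leaf for the part of $\Delta$ right of $q_i$, and whose left child is the rest; then a curve node $cv_i$ with one child leaf for the part of the remaining piece above $cv_i$ and one for the part below $cv_i$. Finally,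 neighbouring new pieces that belong to the same trapezoid of $\mathcal T(S_i)$ (because the wall between them is now blocked by $cv_i$) are merged into one shared leaf. $\mathbb G=\mathbb G_n$. A search for a query point $q$ starts at the root; at a point node $p$ it moves left or right according to whether $q$ is to the left or right of the vertical line through $p$, and at a curve node it moves according to whether $q$ is above or below the curve, until it reaches a leaf. $\mathcal D$ is the length of the longest directed path in $\mathbb G$ from the root to a leaf. $\mathcal L$ is the length of the longest search path, i.e. the longest root-to-leaf path that is followed by the search for some query point $q$. *)

(* Defs.v *)
From HB Require Import structures.
From mathcomp Require Import all_boot all_order all_algebra.
From mathcomp Require Import all_classical all_reals all_analysis.

Set Implicit Arguments.
Unset Strict Implicit.
Unset Printing Implicit Defensive.

Import Order.TTheory GRing.Theory Num.Theory.
Import numFieldNormedType.Exports.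

Local Open Scope classical_set_scope.
Local Open Scope ring_scope.

Section TrapezoidalMaps.
Variable R : realType.

Definition plane : Type := (R * R)%type.

(* A bounded x-monotone curve is the graph of a continuous function over a
   compact interval; the values of [ordinate] outside [xleft, xright] are
   irrelevant. *)
Record curve : Type := Curve {
  xleft : R;
  xright : R;
  ordinate : R -> R;
  xleft_lt_xright : xleft < xright;
  ordinate_continuous : {within `[xleft, xright], continuous ordinate}
}.

Implicit Types (c : curve) (S : set curve) (p q z : plane) (D F : set plane).

Definition lendpoint c : plane := (xleft c, ordinate c (xleft c)).
Definition rendpoint c : plane := (xright c, ordinate c (xright c)).

Definition points c : set plane :=
  [set z | xleft c <= z.1 <= xright c /\ z.2 = ordinate c z.1].

Definition rel_interior c : set plane :=
  [set z | xleft c < z.1 < xright c /\ z.2 = ordinate c z.1].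

Definition above c z : Prop :=
  xleft c <= z.1 <= xright c /\ ordinate c z.1 < z.2.
Definition below c z : Prop :=
  xleft c <= z.1 <= xright c /\ z.2 < ordinate c z.1.

Definition endpoints S : set plane :=
  [set z | exists2 c, S c & z = lendpoint c \/ z = rendpoint c].

(* The second clause needs no [c <> d]: the endpoints of a curve never lie in
   its own relative interior. *)
Definition general_position S : Prop :=
  (forall p q, endpoints S p -> endpoints S q -> p.1 = q.1 -> p = q) /\
  (forall p c, endpoints S p -> S c -> ~ rel_interior c p).

Definition skeleton S : set plane := \bigcup_(c in S) points c.

(* The open vertical segment or ray going up (down) from p that stops before
   the first point of a curve of S strictly above (below) p. *)
Definition upper_wall S p : set plane :=
  [set z | [/\ z.1 = p.1, p.2 < z.2 &
             forall y, p.2 < y <= z.2 -> ~ skeleton S (p.1, y)]].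
Definition lower_wall S p : set plane :=
  [set z | [/\ z.1 = p.1, z.2 < p.2 &
             forall y, z.2 <= y < p.2 -> ~ skeleton S (p.1, y)]].

Definition walls S : set plane :=
  \bigcup_(p in endpoints S) (upper_wall S p `|` lower_wall S p).

Definition trapezoid S : set (set plane) :=
  let U := ~` (skeleton S `|` walls S) in
  [set D | exists2 z, U z & D = connected_component U z].

(* An inner node remembers the trapezoid whose leaf it replaced; this gives
   distinct identities to nodes that carry the same point or curve. *)
Inductive node : Type :=
| Leaf of set plane
| PointNode of set plane & plane
| CurveNode of set plane & curve.

Inductive side : Type := ToLeft | ToRight | ToAbove | ToBelow.

Record dag : Type := Dag {
  dag_root : node;
  dag_edge : node -> side -> node -> Prop
}.

Definition hit c D : Prop := points c `&` D !=set0.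

(* Top node of the part of the replacement of the leaf D that lies below the
   node of the left endpoint, and top node of the whole replacement. *)
Definition entry_right c D : node :=
  if rendpoint c \in D then PointNode D (rendpoint c) else CurveNode D c.
Definition entry c D : node :=
  if lendpoint c \in D then PointNode D (lendpoint c) else entry_right c D.

Definition left_part c D : set plane :=
  D `&` [set z | z.1 < xleft c].
Definition right_part c D : set plane :=
  D `&` [set z | xright c < z.1].
Definition middle_part c D : set plane :=
  D `&` [set z | (D (lendpoint c) -> xleft c < z.1) /\
                 (D (rendpoint c) -> z.1 < xright c)].

(* The edges leaving the nodes that replace the leaf D when c is inserted; T is
   the set of trapezoids after the insertion. A piece P of D becomes the leaf of
   the trapezoid of T that contains P, so that the pieces lying in the same
   trapezoid of T share one leaf. *)
Inductive new_edge (T : set (set plane)) c D : node -> side -> node -> Prop :=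
| new_lpoint_left F : D (lendpoint c) -> T F -> left_part c D `<=` F ->
    new_edge T c D (PointNode D (lendpoint c)) ToLeft (Leaf F)
| new_lpoint_right : D (lendpoint c) ->
    new_edge T c D (PointNode D (lendpoint c)) ToRight (entry_right c D)
| new_rpoint_left : D (rendpoint c) ->
    new_edge T c D (PointNode D (rendpoint c)) ToLeft (CurveNode D c)
| new_rpoint_right F : D (rendpoint c) -> T F -> right_part c D `<=` F ->
    new_edge T c D (PointNode D (rendpoint c)) ToRight (Leaf F)
| new_curve_above F : T F -> middle_part c D `&` above c `<=` F ->
    new_edge T c D (CurveNode D c) ToAbove (Leaf F)
| new_curve_below F : T F -> middle_part c D `&` below c `<=` F ->
    new_edge T c D (CurveNode D c) ToBelow (Leaf F).

Definition replace c (n : node) : node :=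
  if n is Leaf D then if `[< hit c D >] then entry c D else Leaf D else n.

Definition insert S c (G : dag) : dag := {|
  dag_root := replace c (dag_root G);
  dag_edge := fun n s m =>
    (exists2 m0, dag_edge G n s m0 & m = replace c m0) \/
    (exists D, [/\ trapezoid S D, hit c D &
                 new_edge (trapezoid (c |` S)) c D n s m])
|}.

(* The insertion order is cv 0, cv 1, ..., cv n.-1; the curves cv i with
   n <= i play no role. *)
Definition prefix_set (cv : nat -> curve) (i : nat) : set curve :=
  cv @` `I_i.

Fixpoint history (cv : nat -> curve) (i : nat) : dag :=
  if i is j.+1 then insert (prefix_set cv j) (cv j) (history cv j)
  else {| dag_root := Leaf [set: plane]; dag_edge := fun _ _ _ => False |}.

(* Pairwise disjointness of the nonempty relative interiors makes the n curves
   pairwise distinct. *)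
Definition admissible (n : nat) (cv : nat -> curve) : Prop :=
  trivIset `I_n (fun i => rel_interior (cv i)) /\
  general_position (prefix_set cv n).

Inductive walk (E : node -> node -> Prop) : node -> nat -> node -> Prop :=
| walk_nil n : walk E n 0 n
| walk_cons n m k l : E n m -> walk E m k l -> walk E n k.+1 l.

Definition arrow (G : dag) (n m : node) : Prop := exists s, dag_edge G n s m.

(* A query on the vertical line of a point node or on the curve of a curve node
   is not directed to either child. *)
Definition directs q (n : node) (s : side) : Prop :=
  match n, s with
  | PointNode _ p, ToLeft => q.1 < p.1
  | PointNode _ p, ToRight => p.1 < q.1
  | CurveNode _ c, ToAbove => above c q
  | CurveNode _ c, ToBelow => below c q
  | _, _ => False
  end.

Definition search_arrow (G : dag) q (n m : node) : Prop :=
  exists2 s, dag_edge G n s m & directs q n s.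

Definition path_lengths (G : dag) : set nat :=
  [set k | exists D, walk (arrow G) (dag_root G) k (Leaf D)].

Definition search_path_lengths (G : dag) : set nat :=
  [set k | exists q D, walk (search_arrow G q) (dag_root G) k (Leaf D)].

Local Open Scope ereal_scope.

Definition longest (K : set nat) : \bar R :=
  ereal_sup [set (k%:R)%:E | k in K].

Definition depth (G : dag) : \bar R := longest (path_lengths G).

Definition max_query_length (G : dag) : \bar R :=
  longest (search_path_lengths G).

Definition worst_ratio (n : nat) : \bar R :=
  ereal_sup [set depth (history cv n) / max_query_length (history cv n)
            | cv in admissible n].

End TrapezoidalMaps.

(* Main.v *)
(* Upper bound: an insertion lengthens a path by at most three nodes, so the
   depth is at most 3n. For each of the n curves take a query point just above
   it. All points of a trapezoid have the same curve directly below them, so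
   these queries end in n distinct leaves; the out-degree is at most two, hence
   one of the search paths has length at least log2 n.

   Lower bound: half of the curves are short segments inserted in van der Corput
   order, which cuts the plane into narrow strips at logarithmic search depth.
   The others form a staircase of overlapping steps inserted from left to right:
   the trapezoid above a step is cut by the left end of the next step and its
   right part is merged into the trapezoid above that step, so a directed path
   gains two nodes per step, while a query point is affected by boundedly many
   steps only. *)

Require Import Defs.
From HB Require Import structures.
From mathcomp Require Import all_boot all_order all_algebra.
From mathcomp Require Import all_classical all_reals all_analysis.
From mathcomp Require Import zify ring lra.
Import Order.TTheory GRing.Theory Num.Theory.
Import numFieldNormedType.Exports.

Set Implicit Arguments.
Unset Strict Implicit.
Unset Printing Implicit Defensive.

Local Open Scope classical_set_scope.
Local Open Scope ring_scope.

(** * Finite and connected sets *)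

(** Trapezoids are given only as connected components, and a piece is assigned to a leaf by
    inclusion, so connectedness has to be controlled without a list of cells. The tool is the curve
    seen first when looking straight down or up from a point. A point off the curves avoids all
    walls exactly when its abscissa is interior to every curve so seen, and what is seen there is
    locally constant. From this follow the convexity of vertical slices, the fact that a hitting
    curve stays in the trapezoid over all common abscissas, and the survival of unhit trapezoids.

    Search cost is bounded without tracing searches: it is at most three times the number of
    insertions that hit the trapezoid containing the query. In the example these hits are counted by
    separation. A trapezoid meets the vertical line of an earlier left endpoint only if it lies
    within the extent of a step; otherwise the line keeps apart two hit trapezoids, which then share
    no query. The steps must be long enough that consecutive ones overlap, for the depth, and short
    enough that such lines survive between distant ones. *)

Lemma finite_set_elim (T : Type) (P : set T -> Prop) :
  P set0 -> (forall x A, finite_set A -> P A -> P (x |` A)) ->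
  forall A, finite_set A -> P A.
Proof.
move=> P0 PU A /finite_setP[n]; elim: n A => [|n IHn] A.
  by rewrite II0 card_eq0 => /eqP ->.
move=> /eq_cardSP[x Ax AxI]; rewrite -(setD1K Ax); apply: PU; last exact: IHn.
by apply/finite_setP; exists n.
Qed.

Lemma near_finite_set (T I : Type) (F : set_system T) (A : set I)
    (P : I -> set T) {FF : Filter F} : finite_set A ->
  (forall i, A i -> \forall x \near F, P i x) ->
  \forall x \near F, forall i, A i -> P i x.
Proof.
move: A; apply: finite_set_elim => [|i A _ IHA] PA.
  exact: filterE.
have := IHA (fun j Aj => PA j (or_intror Aj)); have := PA i (or_introl erefl).
by apply: filterS2 => x Pi PAx j [->//|/PAx].
Qed.

Lemma finite_set_argmin (R : realDomainType) (I : Type) (A : set I)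
    (f : I -> R) : finite_set A -> A !=set0 ->
  exists2 i, A i & forall j, A j -> f i <= f j.
Proof.
move: A; apply: finite_set_elim => [[]//|i A _ IHA _].
have [A0|/set0P/IHA[k Ak kmin]] := eqVneq A set0.
  by exists i; [left | move=> j; rewrite A0 => -[->|]].
have [fik|/ltW fki] := leP (f i) (f k).
  exists i; [by left | move=> j [->//|/kmin]]; exact: le_trans.
by exists k; [right | move=> j [->//|/kmin]].
Qed.

Section ConnectedSets.
Variable T : topologicalType.
Implicit Types A : set T.

Lemma connected_locally_constant A (P : T -> Prop) x y : connected A ->
  (forall z, A z -> P z -> \forall w \near z, A w -> P w) ->
  (forall z, A z -> ~ P z -> \forall w \near z, A w -> ~ P w) ->
  A x -> P x -> A y -> P y.
Proof.
move=> Ac Pnear Nnear Ax Px Ay.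
suff AP : A `&` [set z | P z] = A by rewrite -AP in Ay; case: Ay.
apply: (Ac); first by exists x.
- exists (interior [set z | A z -> P z]); first exact: open_interior.
  apply/seteqP; split=> z [Az].
    by move=> Pz; split=> //; apply: Pnear.
  by move=> /interior_subset/(_ Az).
- exists (~` interior [set z | A z -> ~ P z]).
    by apply: open_closedC; exact: open_interior.
  apply/seteqP; split=> z [Az].
    by move=> Pz; split=> // /interior_subset/(_ Az).
  move=> nz; split=> //; apply: contrapT => nPz; apply: nz; exact: Nnear.
Qed.

Lemma connected_component_eq A (x y z : T) :
  connected_component A x z -> connected_component A y z ->
  connected_component A x = connected_component A y.
Proof.
move=> xz /connected_component_sym zy.
by apply: same_connected_component; apply: connected_component_trans zy.
Qed.

End ConnectedSets.

Section ConnectedPlane.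
Variable R : realType.
Implicit Types (P D : set (plane R)) (z w : plane R).

Lemma near_box z e : 0 < e ->
  \forall w \near z, `|z.1 - w.1| < e /\ `|z.2 - w.2| < e.
Proof.
move=> e0; have : nbhs z (ball z e) by apply: nbhsx_ballx.
by apply: filterS => w [].
Qed.

Lemma near_box_ex P z : (\forall w \near z, P w) ->
  exists2 e, 0 < e & forall w, `|z.1 - w.1| < e -> `|z.2 - w.2| < e -> P w.
Proof.
by move=> /nbhs_ballP[e /= e0 He]; exists e => // w w1 w2; apply: He.
Qed.

Definition vertically_convex P := forall x y1 y2 y,
  P (x, y1) -> P (x, y2) -> y1 <= y <= y2 -> P (x, y).

Lemma vertical_connected x (y1 y2 : R) :
  connected ((fun y => (x, y) : plane R) @` `[y1, y2]).
Proof.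
apply: connected_continuous_connected; first exact: segment_connected.
apply: continuous_subspaceT => y; exact: (cvg_pair (cvg_cst _) cvg_id).
Qed.

Lemma horizontal_near P x y : open P -> P (x, y) ->
  \forall x' \near x, P (x', y).
Proof.
move=> oP Pxy; have /near_box_ex[e e0 He] : nbhs (x, y) P by apply: open_nbhs_nbhs.
near=> x'; apply: He => /=; last by rewrite subrr normr0.
by near: x'; apply: (nbhsx_ballx x e e0).
Unshelve. all: by end_near. Qed.

(** Columns of [P] are segments, so a relatively clopen subset that meets a column contains it. The
    abscissas of the columns it meets then form a relatively clopen part of an interval, because
    openness of [P] allows points to be moved sideways. *)
Lemma connected_vertically_convex P : open P -> vertically_convex P ->
  (forall z w x, P z -> P w -> z.1 <= x <= w.1 -> exists y, P (x, y)) ->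
  connected P.
Proof.
move=> oP vP hP B [[x0 y0] Bz] [C oC BC] [C' cC' BC'].
have sBP : B `<=` P by rewrite BC => ? [].
have oB : open B by rewrite BC; exact: openI.
have oN : open (P `&` ~` C') by apply: openI => //; exact: closed_openC.
have NB z : P z -> ~ B z -> (P `&` ~` C') z.
  by move=> Pz nB; split=> // C'z; apply: nB; rewrite BC'.
have colB x y y' : P (x, y) -> P (x, y') -> B (x, y) -> B (x, y').
  move=> Pxy Pxy' Bxy.
  pose A := (fun y => (x, y) : plane R) @` `[Num.min y y', Num.max y y'].
  have AP : A `<=` P.
    move=> w [v /=]; rewrite in_itv /= => hv <-.
    by case: (leP y y') hv => _ hv; apply: (vP x _ _ v _ _ hv).
  have Ay : A (x, y) by exists y => //=; rewrite in_itv /= ge_min le_max lexx.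
  have Ay' : A (x, y').
    by exists y' => //=; rewrite in_itv /= ge_min le_max !lexx !orbT.
  apply: (@connected_locally_constant _ A B (x, y)) => //.
  - exact: vertical_connected.
  - move=> z Az Bz'; have : nbhs z B by apply: open_nbhs_nbhs.
    by apply: filterS.
  - move=> z Az nBz; have : nbhs z (P `&` ~` C').
      by apply: open_nbhs_nbhs; split=> //; apply: NB => //; exact: AP.
    by apply: filterS => w [Pw nw] _; rewrite BC' => -[].
apply/seteqP; split=> // -[x1 y1] Pw.
have Pz := sBP _ Bz.
pose I := [set` `[Num.min x0 x1, Num.max x0 x1]].
have PI x : I x -> exists y, P (x, y).
  rewrite /I/= in_itv /=.
  case: (leP x0 x1) => _ hx; [exact: (hP _ _ _ Pz Pw hx)|exact: (hP _ _ _ Pw Pz hx)].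
have I0 : I x0 by rewrite /I/= in_itv /= ge_min le_max lexx.
have I1 : I x1 by rewrite /I/= in_itv /= ge_min le_max !lexx !orbT.
have [y' By'] : exists y, B (x1, y).
  apply: (@connected_locally_constant _ I (fun x => exists y, B (x, y)) x0) => //.
  - exact: segment_connected.
  - move=> x _ [y Bxy]; have := horizontal_near oB Bxy.
    by apply: filterS => x' Bx' _; exists y.
  - move=> x /PI[y Pxy] nB.
    have := horizontal_near oN (NB _ Pxy (fun b => nB (ex_intro _ y b))).
    apply: filterS => x' [Px' Nx'] _ [v Bv].
    by have := colB _ _ _ (sBP _ Bv) Px' Bv; rewrite BC' => -[].
  - by exists y0.
exact: (colB _ _ _ (sBP _ By') Pw By').
Unshelve. all: by end_near. Qed.

Lemma connected_plane : connected [set: plane R].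
Proof.
apply: connected_vertically_convex => //; first exact: openT.
by move=> z w x _ _ _; exists 0.
Qed.

Lemma connected_fst D z w x : connected D -> D z -> D w -> z.1 <= x <= w.1 ->
  exists y, D (x, y).
Proof.
move=> cD Dz Dw hx.
have : connected (fst @` D).
  apply: connected_continuous_connected => //.
  by apply: continuous_subspaceT => ?; exact: cvg_fst.
move=> /connected_intervalP/(_ z.1 w.1).
have /[swap]/[apply] : (fst @` D) z.1 by exists z.
have /[swap]/[apply] : (fst @` D) w.1 by exists w.
by move=> /(_ x hx)[[u v] Duv <-]; exists v.
Qed.

Lemma connected_box z e : 0 < e ->
  connected [set w : plane R | `|z.1 - w.1| < e /\ `|z.2 - w.2| < e].
Proof.
move=> e0; apply: connected_vertically_convex.
- have -> : [set w : plane R | `|z.1 - w.1| < e /\ `|z.2 - w.2| < e] = ball z e.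
    by [].
  exact: ball_open.
- move=> x y1 y2 y [/= ? h1] [_ /= h2] hy; split=> //=.
  by move: h1 h2; rewrite !ltr_norml => *; lra.
- move=> u w x [hu _] [hw _] hx; exists z.2; split=> /=; last first.
    by rewrite subrr normr0.
  by move: hu hw; rewrite !ltr_norml => *; lra.
Qed.

Lemma open_connected_component D z : open D -> open (connected_component D z).
Proof.
move=> oD; rewrite openE => w Dw.
have /near_box_ex[e e0 He] : \forall v \near w, D v.
  by apply: open_nbhs_nbhs; split=> //; exact: connected_component_sub Dw.
apply: filterS (near_box w e0) => v hv; apply: connected_component_trans Dw _.
apply: (connected_component_max _ _ (@connected_box w e e0)) => //=.
  by rewrite !subrr !normr0.
by move=> u [/He]; apply.
Qed.

End ConnectedPlane.

(** * Curves and trapezoids *)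

Section CurveGeometry.
Variable R : realType.
Implicit Types (c d e : curve R) (S : set (curve R)) (D : set (plane R)).
Implicit Types (z w p : plane R) (s : bool).

Lemma near_lt (f g : plane R -> R) z : continuous f -> continuous g ->
  f z < g z -> \forall w \near z, f w < g w.
Proof.
move=> cf cg fg; have cgf : (fun w => g w - f w) @ z --> g z - f z.
  by apply: cvgB; [exact: cg|exact: cf].
have : \forall w \near z, 0 < g w - f w by apply: (cvgr_gt _ cgf); rewrite subr_gt0.
by apply: filterS => w; rewrite subr_gt0.
Qed.

Lemma near_and (P Q : plane R -> Prop) z : (\forall w \near z, P w) ->
  (\forall w \near z, Q w) -> \forall w \near z, P w /\ Q w.
Proof. exact: filterI. Qed.

Definition spans c (x : R) := xleft c <= x <= xright c.

(** Clamping the abscissa extends the curve to a continuous function on the whole line, so strict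
    comparisons with it are open conditions. Whether the curve really reaches over [x] is kept
    apart, in [spans]. *)
Definition height c (x : R) : R :=
  ordinate c (Num.max (xleft c) (Num.min x (xright c))).

Lemma heightE c x : spans c x -> height c x = ordinate c x.
Proof.
move=> /andP[lx xr]; rewrite /height; congr (ordinate c _).
by rewrite (min_idPl xr) (max_idPr lx).
Qed.

Lemma continuous_height c : continuous (height c).
Proof.
move=> x; have /subspace_continuousP cc := @ordinate_continuous _ c.
pose clamp (x : R) : R := Num.max (xleft c) (Num.min x (xright c)).
have lr := ltW (xleft_lt_xright c).
have Iclamp y : clamp y \in `[xleft c, xright c].
  by rewrite in_itv /= /clamp le_max lexx /= ge_max lr ge_min lexx orbT.
have cclamp : clamp @ x --> clamp x.
  apply: (@continuous_max R R (cst (xleft c)) (fun y => Num.min y (xright c)) x).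
    exact: cvg_cst.
  apply: (@continuous_min R R id (cst (xright c)) x); first exact: cvg_id.
  exact: cvg_cst.
have := cc (clamp x) (Iclamp x); apply: cvg_trans.
apply: (@cvg_comp _ _ _ clamp (ordinate c) _ (within `[xleft c, xright c] (nbhs (clamp x)))) => //.
move=> A wA; change (\forall y \near x, A (clamp y)).
have : \forall y \near x, [set` `[xleft c, xright c]] (clamp y) -> A (clamp y).
  exact: (cclamp _ wA).
by apply: filterS => y; apply; exact: Iclamp.
Qed.

(** The boolean selects the side, so that looking down ([true]) and looking up ([false]) are treated
    by one proof. *)
Definition gap s c z := if s then z.2 - height c z.1 else height c z.1 - z.2.

Lemma continuous_gap s c : continuous (gap s c).
Proof.
have c2 : continuous (fun z : plane R => z.2) by move=> z; exact: cvg_snd.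
have ch : continuous (fun z : plane R => height c z.1).
  move=> z; apply: (@continuous_comp _ _ _ (fun z : plane R => z.1) (height c)).
    exact: cvg_fst.
  exact: continuous_height.
by case: s => z; apply: cvgB; [exact: c2|exact: ch|exact: ch|exact: c2].
Qed.

Lemma gap_pos_ex c z : z.2 <> height c z.1 -> exists s, 0 < gap s c z.
Proof.
move=> /eqP; rewrite neq_lt => /orP[] h; [exists false|exists true].
all: by rewrite /gap subr_gt0.
Qed.

Definition inside c (x : R) := xleft c < x < xright c.

Lemma insideW c x : inside c x -> spans c x.
Proof. by move=> /andP[/ltW a /ltW b]; apply/andP. Qed.

Lemma spans_inside c x : spans c x -> x <> xleft c -> x <> xright c -> inside c x.
Proof.
by move=> /andP[a b] /eqP nl /eqP nr; rewrite /inside !lt_neqAle a b eq_sym nl nr.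
Qed.

Lemma spans_left c : spans c (xleft c).
Proof. by rewrite /spans lexx ltW ?xleft_lt_xright. Qed.

Lemma spans_right c : spans c (xright c).
Proof. by rewrite /spans lexx ltW ?xleft_lt_xright. Qed.

Lemma pointsP c z : points c z <-> spans c z.1 /\ z.2 = height c z.1.
Proof.
by split=> -[cz zh]; split=> //; [rewrite heightE|rewrite -heightE].
Qed.

Lemma points_height c x : spans c x -> points c (x, height c x).
Proof. by move=> cx; apply/pointsP. Qed.

Lemma rel_interiorP c z : rel_interior c z <-> inside c z.1 /\ z.2 = height c z.1.
Proof.
by split=> -[cz zh]; split=> //; [rewrite heightE//|rewrite -heightE//];
  exact: insideW.
Qed.

Lemma lendpointE c : lendpoint c = (xleft c, height c (xleft c)).
Proof. by rewrite /lendpoint heightE// spans_left. Qed.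

Lemma rendpointE c : rendpoint c = (xright c, height c (xright c)).
Proof. by rewrite /rendpoint heightE// spans_right. Qed.

Lemma endpoints_height S c x : S c -> x = xleft c \/ x = xright c ->
  endpoints S (x, height c x).
Proof.
move=> Sc xe; exists c => //; case: xe => ->.
  by left; rewrite lendpointE.
by right; rewrite rendpointE.
Qed.

Definition arrangement S :=
  [/\ finite_set S,
      forall c d z, S c -> S d -> c <> d -> rel_interior c z -> ~ rel_interior d z &
      general_position S].

Lemma sub_arrangement S S' : S `<=` S' -> arrangement S' -> arrangement S.
Proof.
move=> sS [fS dS [g1 g2]]; have sE : endpoints S `<=` endpoints S'.
  by move=> p [c Sc pc]; exists c => //; exact: sS.
split; first exact: sub_finite_set fS.
  by move=> c d z /sS Sc /sS Sd; exact: dS.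
split=> [p q /sE Ep /sE Eq|p c /sE Ep /sS Sc]; [exact: g1|exact: g2].
Qed.

(** At equal heights a point of [c] would lie in the interior of [d]: if it is an endpoint of [c],
    this violates general position, otherwise disjointness. With [spans d x] the claim would fail,
    since curves may share endpoints. *)
Lemma height_neq S c d x : arrangement S -> S c -> S d -> c <> d ->
  spans c x -> inside d x -> height c x <> height d x.
Proof.
move=> [_ dS [_ gS]] Sc Sd ncd cx dx eqh.
have dI : rel_interior d (x, height c x) by apply/rel_interiorP.
have [xl|nl] := pselect (x = xleft c).
  by apply: (gS _ _ _ Sd dI); apply: endpoints_height => //; left.
have [xr|nr] := pselect (x = xright c).
  by apply: (gS _ _ _ Sd dI); apply: endpoints_height => //; right.
by apply: (dS c d _ Sc Sd ncd _ dI); apply/rel_interiorP; split=> //; exact: spans_inside.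
Qed.

(* [facing true S d z]: [d] is the first curve of [S] met by going down from
   [z]; [facing false S d z]: by going up. *)
Definition facing s S d z :=
  [/\ S d, spans d z.1, 0 < gap s d z &
      forall e, S e -> spans e z.1 -> 0 < gap s e z -> gap s d z <= gap s e z].

Definition unwalled S : set (plane R) := ~` (skeleton S `|` walls S).

Lemma facing_ex s S e z : finite_set S -> S e -> spans e z.1 -> 0 < gap s e z ->
  exists2 d, facing s S d z & gap s d z <= gap s e z.
Proof.
move=> fS Se ez ge.
have [||d [Sd [dz gd]] dmin] := @finite_set_argmin _ _
    (S `&` [set e | spans e z.1 /\ 0 < gap s e z]) (fun e => gap s e z).
- exact: finite_setIl.
- by exists e.
exists d; last by apply: dmin.
by split=> // e' Se' e'z ge'; apply: dmin.
Qed.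

Lemma gap_eq s c d z : height c z.1 = height d z.1 <-> gap s c z = gap s d z.
Proof. by rewrite /gap; case: s; split; lra. Qed.

Lemma facing_unique s S d d' z : arrangement S -> inside d z.1 ->
  facing s S d z -> facing s S d' z -> d' = d.
Proof.
move=> aS di [Sd dz gd dmin] [Sd' d'z gd' d'min].
apply: contrapT => nd; apply: (height_neq aS Sd' Sd nd d'z di).
by apply/(gap_eq s); apply/le_anti; rewrite dmin// d'min.
Qed.

(** If a wall passes through [z], the curve whose endpoint emits it is faced from [z] and ends over
    the abscissa of [z]; conversely a faced curve that ends there emits such a wall. Walls thus
    become a condition on the faced curves alone. *)
Lemma unwalledP S z : unwalled S z <->
  (forall e, S e -> spans e z.1 -> z.2 <> height e z.1) /\
  (forall s d, facing s S d z -> inside d z.1).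
Proof.
split=> [/not_orP[nsk nw]|[off fac] [[c Sc /pointsP[cz zh]]|[p]]].
- have off e : S e -> spans e z.1 -> z.2 <> height e z.1.
    by move=> Se ez zh; apply: nsk; exists e => //; apply/pointsP.
  split=> // s d [Sd dz gd dmin]; apply: contrapT => ndi; apply: nw.
  have xe : z.1 = xleft d \/ z.1 = xright d.
    by apply: contrapT => /not_orP[nl nr]; apply: ndi; exact: spans_inside.
  exists (z.1, height d z.1); first exact: endpoints_height.
  case: s gd dmin => gd dmin; [left|right]; split=> //=;
    rewrite ?(subr_gt0, subr_lt0)//; try by move: gd; rewrite /gap subr_gt0.
  + move=> y /andP[dy yz] [e Se /pointsP[/= ez yE]].
    have nyz : y <> z.2 by move=> yz2; apply: (off e Se ez); rewrite -yE.
    have {}yz : y < z.2 by rewrite lt_neqAle yz andbT; apply/eqP.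
    have := dmin e Se ez; rewrite /gap -yE; lra.
  + move=> y /andP[dy yz] [e Se /pointsP[/= ez yE]].
    have nyz : y <> z.2 by move=> yz2; apply: (off e Se ez); rewrite -yE.
    have {}dy : z.2 < y by rewrite lt_neqAle dy andbT eq_sym; apply/eqP.
    have := dmin e Se ez; rewrite /gap -yE; lra.
- exact: (off c Sc cz zh).
- move=> [c Sc pE].
  have [cp ph pend] : [/\ spans c p.1, p.2 = height c p.1 & ~~ inside c p.1].
    case: pE => ->; rewrite ?lendpointE ?rendpointE /= /inside ltxx ?andbF //.
      by rewrite spans_left.
    by rewrite spans_right.
  move=> [|] [zp pz blk]; apply: (negP pend).
    rewrite -zp; apply: (fac true); split=> //; rewrite ?zp//.
      by rewrite /gap zp -ph subr_gt0.
    move=> e Se ez; rewrite /gap zp -ph => ge; rewrite leNgt; apply/negP => ge'.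
    apply: (blk (height e p.1)); first by apply/andP; split; lra.
    by exists e => //; exact: points_height.
  rewrite -zp; apply: (fac false); split=> //; rewrite ?zp//.
    by rewrite /gap zp -ph subr_gt0.
  move=> e Se ez; rewrite /gap zp -ph => ge; rewrite leNgt; apply/negP => ge'.
  apply: (blk (height e p.1)); first by apply/andP; split; lra.
  by exists e => //; exact: points_height.
Qed.

Lemma continuous_abscissa : continuous (fun z : plane R => z.1).
Proof. by move=> z; exact: cvg_fst. Qed.

Lemma near_inside c z : inside c z.1 -> \forall w \near z, inside c w.1.
Proof.
move=> /andP[lz zr].
have Hl : \forall w \near z, xleft c < w.1.
  apply: (near_lt _ continuous_abscissa lz); move=> ?; exact: cvg_cst.
have Hr : \forall w \near z, w.1 < xright c.
  apply: (near_lt continuous_abscissa _ zr); move=> ?; exact: cvg_cst.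
by apply: filterS2 Hl Hr => w lw wr; apply/andP.
Qed.

Lemma near_spans c z : \forall w \near z, spans c w.1 -> spans c z.1.
Proof.
have [cz|] := boolP (spans c z.1); first exact: filterE.
rewrite negb_and -!ltNge => /orP[] h.
  have : \forall w \near z, w.1 < xleft c.
    apply: (near_lt continuous_abscissa _ h); move=> ?; exact: cvg_cst.
  by apply: filterS => w wl; rewrite /spans leNgt wl.
have : \forall w \near z, xright c < w.1.
  apply: (near_lt _ continuous_abscissa h); move=> ?; exact: cvg_cst.
by apply: filterS => w rw; rewrite /spans [w.1 <= _]leNgt rw andbF.
Qed.

Lemma near_gap_pos s c z : 0 < gap s c z -> \forall w \near z, 0 < gap s c w.
Proof.
have c0 : continuous (fun _ : plane R => 0 : R) by move=> w; exact: cvg_cst.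
exact: (near_lt c0 (@continuous_gap s c)).
Qed.

(** The condition [spans] is closed and gaps are continuous, so near [z] no curve comes into reach
    and none changes side. *)
Lemma near_gap S z : finite_set S -> unwalled S z ->
  \forall w \near z, forall e, S e -> spans e w.1 ->
    [/\ spans e z.1, w.2 <> height e w.1 &
        forall s, 0 < gap s e w -> 0 < gap s e z].
Proof.
move=> fS /unwalledP[off _].
apply: (@near_finite_set (plane R) (curve R) (nbhs z) S (fun e w => spans e w.1 ->
    [/\ spans e z.1, w.2 <> height e w.1 &
        forall s, 0 < gap s e w -> 0 < gap s e z])) => // e Se.
have [ez|nez] := boolP (spans e z.1); last first.
  by have := near_spans e z; apply: filterS => w h /h; rewrite (negbTE nez).
have [s0 gs0] := gap_pos_ex (off e Se ez).
have := near_gap_pos gs0; apply: filterS => w gw ew; split=> // [wh|s gsw].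
  by move: gw; rewrite /gap wh; case: (s0); lra.
suff -> : s = s0 by [].
by case: s s0 gsw gw {gs0} => -[]; rewrite /gap //; lra.
Qed.

(** Strict inequalities between gaps persist near [z]. A tie at [z] cannot occur: the abscissa is
    interior to [d], so [height_neq] forces the tied curve to be [d]. *)
Lemma near_facing s S d z : arrangement S -> unwalled S z -> facing s S d z ->
  \forall w \near z, facing s S d w /\ inside d w.1.
Proof.
move=> aS Fz [Sd dz gd dmin]; have fS : finite_set S by case: aS.
have /unwalledP[_ /(_ s d (And4 Sd dz gd dmin)) di] := Fz.
have H1 := near_gap fS Fz; have H2 := near_inside di.
have H3 : \forall w \near z, forall e, S e -> gap s d z < gap s e z ->
    gap s d w < gap s e w.
  apply: (@near_finite_set (plane R) (curve R) (nbhs z) S (fun e w => gap s d z < gap s e z ->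
    gap s d w < gap s e w)) => // e Se.
  have [lt|nlt] := boolP (gap s d z < gap s e z); last exact: filterE.
  by have := near_lt (@continuous_gap s d) (@continuous_gap s e) lt; apply: filterS.
have H4 := near_gap_pos gd.
have := near_and (near_and H1 H2) (near_and H3 H4).
apply: filterS => w [[h1 h2] [h3 h4]]; split=> //.
split=> //; first exact: insideW.
move=> e Se ew gew; have [ez _ /(_ s gew) gez] := h1 e Se ew.
have := dmin e Se ez gez; rewrite le_eqVlt => /orP[/eqP gE|/(h3 e Se)/ltW//].
suff -> : e = d by [].
apply: contrapT => ned; apply: (height_neq aS Se Sd ned ez di).
by apply/(gap_eq s).
Qed.

Lemma near_unfacing s S z : finite_set S -> unwalled S z ->
  (forall d, ~ facing s S d z) -> \forall w \near z, forall d, ~ facing s S d w.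
Proof.
move=> fS Fz nf; have := near_gap fS Fz; apply: filterS => w h d [Sd dw gd _].
have [dz _ /(_ s gd) gz] := h d Sd dw.
by have [d' /nf] := facing_ex fS Sd dz gz.
Qed.

Lemma open_unwalled S : arrangement S -> open (unwalled S).
Proof.
move=> aS; have fS : finite_set S by case: aS.
rewrite openE => z Fz.
have H s : \forall w \near z, forall d, facing s S d w -> inside d w.1.
  have [[d fd]|nd] := pselect (exists d, facing s S d z).
    have := near_facing aS Fz fd; apply: filterS => w [fdw di] d' fd'.
    by rewrite (facing_unique aS di fdw fd').
  have := near_unfacing fS Fz (fun d fd => nd (ex_intro _ d fd)).
  by apply: filterS => w h d /h.
have := near_and (near_gap fS Fz) (near_and (H true) (H false)).
apply: filterS => w [h1 [ht hf]]; apply/unwalledP; split.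
  by move=> e Se ew; have [] := h1 e Se ew.
by case=> d; [exact: ht|exact: hf].
Qed.

(** * Trapezoids as components, and the curves they face *)

Lemma trapezoid_unwalled S D : trapezoid S D -> D `<=` unwalled S.
Proof. by move=> [z _ ->]; exact: connected_component_sub. Qed.

Lemma trapezoid_connected S D : trapezoid S D -> connected D.
Proof. by move=> [z _ ->]; exact: component_connected. Qed.

Lemma trapezoid_open S D : arrangement S -> trapezoid S D -> open D.
Proof. by move=> aS [z _ ->]; apply: open_connected_component; exact: open_unwalled. Qed.

Lemma trapezoid_max S D A z : trapezoid S D -> D z -> A z -> A `<=` unwalled S ->
  connected A -> A `<=` D.
Proof.
move=> [u _ ->] Dz Az AF cA; rewrite (same_connected_component Dz).
exact: connected_component_max.
Qed.

Lemma trapezoid_eq S D D' z : trapezoid S D -> trapezoid S D' -> D z -> D' z ->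
  D = D'.
Proof. by move=> [u _ ->] [v _ ->] uz vz; exact: connected_component_eq vz. Qed.

Lemma trapezoid_ex S A z : A z -> A `<=` unwalled S -> connected A ->
  exists2 D, trapezoid S D & A `<=` D.
Proof.
move=> Az AF cA; exists (connected_component (unwalled S) z).
  by exists z => //; exact: AF.
exact: connected_component_max.
Qed.

Lemma trapezoid_neq0 S D : trapezoid S D -> D !=set0.
Proof. by move=> [z Fz ->]; exists z; exact: connected_component_refl. Qed.

(** Both facing [d] and not facing it are locally constant at unwalled points, and a trapezoid is
    connected: it has one bottom curve and one top curve, if any. *)
Lemma trapezoid_facing s S D d z w : arrangement S -> trapezoid S D -> D z -> D w ->
  facing s S d z -> facing s S d w.
Proof.
move=> aS tD Dz Dw fz; have fS : finite_set S by case: aS.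
have DF := trapezoid_unwalled tD.
apply: (connected_locally_constant (trapezoid_connected tD) _ _ Dz fz Dw).
  by move=> u Du fu; apply: filterS (near_facing aS (DF _ Du) fu) => v [].
move=> u Du nfu.
have [[d' fd']|nd] := pselect (exists d, facing s S d u).
  have := near_facing aS (DF _ Du) fd'; apply: filterS => v [fv di] _ fdv.
  by apply: nfu; rewrite (facing_unique aS di fv fdv).
have := near_unfacing fS (DF _ Du) (fun d fd => nd (ex_intro _ d fd)).
by apply: filterS => v h _ /h.
Qed.

Lemma trapezoid_inside s S D d z w : arrangement S -> trapezoid S D -> D z ->
  D w -> facing s S d z -> inside d w.1.
Proof.
move=> aS tD Dz Dw fz; have /unwalledP[_] := trapezoid_unwalled tD Dw; apply.
exact: (trapezoid_facing aS tD Dz Dw fz).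
Qed.

(** Along a vertical segment that meets no curve, each curve keeps its side and all gaps on one side
    change by the same amount, so the faced curves remain the same and the segment meets no wall. *)
Lemma trapezoid_slice S D x y y' : trapezoid S D -> D (x, y) ->
  (forall e, S e -> spans e x ->
     ~ (Num.min y y' <= height e x <= Num.max y y')) ->
  D (x, y').
Proof.
move=> tD Dz unblocked.
pose A := (fun v => (x, v) : plane R) @` `[Num.min y y', Num.max y y'].
have Ay : A (x, y) by exists y => //=; rewrite in_itv /= ge_min le_max lexx.
have Ay' : A (x, y').
  by exists y' => //=; rewrite in_itv /= ge_min le_max !lexx !orbT.
apply: (trapezoid_max tD Dz Ay) => //; last exact: vertical_connected.
move=> u [v /=]; rewrite in_itv /= => hv <-; apply/unwalledP; split=> /=.
  by move=> e Se ex vh; apply: (unblocked e Se ex); rewrite -vh.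
have /unwalledP[off fac] := trapezoid_unwalled tD Dz.
have same s e : S e -> spans e x -> (0 < gap s e (x, v)) = (0 < gap s e (x, y)).
  move=> Se ex; have /negP := unblocked e Se ex; rewrite negb_and -!ltNge.
  move: hv; case: (leP y y') => _ /andP[a b] /orP[] h; rewrite /gap /=;
    by case: (s); apply/idP/idP; lra.
move=> s d [Sd dx gd dmin]; apply: (fac s); split=> //=; first by rewrite -same.
move=> e Se ex ge; have := dmin e Se ex; rewrite same// => /(_ ge).
by rewrite /gap /=; case: (s); lra.
Qed.

(** A curve between the two points would force the curve faced downwards from the upper point to be
    at or above the lower one; but the whole trapezoid lies above that curve. *)
Lemma trapezoid_vconvex S D : arrangement S -> trapezoid S D -> vertically_convex D.
Proof.
move=> aS tD x y1 y2 y D1 D2 /andP[y1y yy2].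
apply: (trapezoid_slice tD D1) => e Se ex.
rewrite (min_idPl y1y) (max_idPr y1y) => /andP[y1h hy].
have [] := unwalledP S (x, y1) => /(_ (trapezoid_unwalled tD D1))[/(_ e Se ex) /= n1 _] _.
have [] := unwalledP S (x, y2) => /(_ (trapezoid_unwalled tD D2))[/(_ e Se ex) /= n2 _] _.
have ge : 0 < gap true e (x, y2).
  by rewrite /gap /= subr_gt0 lt_neqAle (le_trans hy yy2) andbT; apply/eqP => h; apply: n2.
have fS : finite_set S by case: aS.
have [d fd gde] := @facing_ex true S e (x, y2) fS Se ex ge.
have [_ _ gd _] := trapezoid_facing aS tD D2 D1 fd.
by move: gd gde; rewrite /gap /=; move/eqP: n1; lra.
Qed.

(* A curve that hits a trapezoid can leave it neither through a curve of [S]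
   nor by ending on one, so it stays in the trapezoid over their common
   abscissas. *)
Lemma hit_height S c D z : arrangement (c |` S) -> trapezoid S D -> hit c D ->
  D z -> spans c z.1 -> D (z.1, height c z.1).
Proof.
move=> aS' tD [w [/pointsP[cw wh] Dw]] Dz cz.
have aS : arrangement S by apply: sub_arrangement aS' => d; right.
have fS : finite_set S by case: aS.
have zE : z = (z.1, z.2) by case: (z).
have [->|/eqP nzh] := eqVneq (height c z.1) z.2; first by rewrite -zE.
have [s gs] := gap_pos_ex (fun h => nzh (esym h)).
apply: contrapT => nD; apply: nD; rewrite zE in Dz.
apply: (trapezoid_slice tD Dz) => e Se ez bet.
have ge : 0 < gap s e z /\ gap s e z <= gap s c z.
  have /unwalledP[/(_ e Se ez) /= /eqP + _] := trapezoid_unwalled tD Dz.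
  rewrite neq_lt => /orP ne; move: gs bet ne; rewrite /gap.
  by case: s; case: (leP z.2 (height c z.1)) => ? ? /andP[? ?] [] ?; split; lra.
have [d fd gde] := facing_ex fS Se ez ge.1.
rewrite -zE in Dz; have [Sd dw gdw _] := trapezoid_facing aS tD Dz Dw fd.
have dzi := trapezoid_inside aS tD Dz Dz fd.
have dwi := trapezoid_inside aS tD Dz Dw fd.
have ncd : c <> d.
  move=> cd; have /unwalledP[/(_ d Sd dw) off _] := trapezoid_unwalled tD Dw.
  by apply: off; rewrite -cd.
(* All of [D] faces [d]. At [z.1] the curve [c] is at or beyond [d], while at [w.1] it passes
   through [w], on the near side of [d]; the intermediate value theorem makes them meet. *)
pose f x := height c x - height d x.
have cf : continuous f by move=> x; apply: cvgB; exact: continuous_height.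
have [x xzw fx] : exists2 x,
    x \in `[Num.min z.1 w.1, Num.max z.1 w.1] & f x = 0.
  apply: IVT; first by rewrite ge_min le_max lexx.
    exact: continuous_subspaceT.
  have : (0 <= f z.1 /\ f w.1 <= 0) \/ (0 <= f w.1 /\ f z.1 <= 0).
    by move: gdw gde ge.2; rewrite /f /gap wh; case: (s); lra.
  case: (leP z.1 w.1) => _ h; rewrite ge_min le_max;
    by apply/andP; split; apply/orP; lra.
have [cx dx] : spans c x /\ inside d x.
  move: xzw dzi dwi cz cw; rewrite in_itv /= /spans /inside.
  by case: (leP z.1 w.1) => _; lra.
have := @height_neq _ c d x aS' (or_introl erefl) (or_intror Sd) ncd cx dx.
by apply; move: fx; rewrite /f; lra.
Qed.

End CurveGeometry.

(** * Inserting a curve into a trapezoidal map *)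

Section Insertion.
Variable R : realType.
Implicit Types (c d e : curve R) (S : set (curve R)) (D F : set (plane R)).
Implicit Types (z w p : plane R) (s : bool).

Lemma unwalled_add S c z : unwalled S z -> (spans c z.1 -> z.2 <> height c z.1) ->
  (forall s, facing s (c |` S) c z -> inside c z.1) -> unwalled (c |` S) z.
Proof.
move=> /unwalledP[off fac] offc facc; apply/unwalledP; split=> [e [->//|/off//]|s d].
move=> fd; have [Sd dz gd dmin] := fd; case: Sd => [dc|Sd].
  by rewrite dc; rewrite dc in fd; apply: (facc s).
by apply: (fac s); split=> // e Se; apply: dmin; right.
Qed.

(** If [c] lies on some side of [z] without being faced, a curve of [S] is at least as near, so
    removing [c] does not change what is seen. *)
Lemma unwalled_sub S c z : finite_set S -> unwalled (c |` S) z ->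
  (forall s, ~ facing s (c |` S) c z) -> unwalled S z.
Proof.
move=> fS /unwalledP[off fac] nc; apply/unwalledP; split=> [e Se|s d [Sd dz gd dmin]].
  by apply: off; right.
apply: (fac s); split=> // [|e [->|/dmin//] cz gc]; first by right.
have fS' : finite_set (c |` S) by rewrite finite_setU; split=> //; exact: finite_set1.
have [d' fd' le_d'] := facing_ex fS' (or_introl erefl : (c |` S) c) cz gc.
apply: le_trans le_d'; have [[d'c|Sd'] d'z gd' _] := fd'; last exact: dmin.
by move: fd'; rewrite d'c => /nc.
Qed.

(** The guards in [middle_part] lose nothing: if [D] reaches an end of [c] or beyond, it has a point
    at the abscissa of that end, and [hit_height] puts the endpoint itself in [D]. *)
Lemma hit_inside S c D z : arrangement (c |` S) -> trapezoid S D -> hit c D ->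
  middle_part c D z <-> D z /\ inside c z.1.
Proof.
move=> aS tD hD; split=> -[Dz]; last by move=> /andP[? ?]; split.
move=> [zl zr]; split=> //.
have [w [/pointsP[/andP[lw wr] _] Dw]] := hD; have lr := ltW (xleft_lt_xright c).
have cD := trapezoid_connected tD.
apply/andP; split; rewrite ltNge; apply/negP => h.
  have [|y Dy] := @connected_fst _ D z w (xleft c) cD Dz Dw; first by rewrite h lw.
  have := hit_height aS tD hD Dy (spans_left c); rewrite -lendpointE => /zl.
  by rewrite ltNge h.
have [|y Dy] := @connected_fst _ D w z (xright c) cD Dw Dz; first by rewrite h wr.
have := hit_height aS tD hD Dy (spans_right c); rewrite -rendpointE => /zr.
by rewrite ltNge h.
Qed.

Definition side_part s c D : set (plane R) :=
  D `&` [set z | inside c z.1 /\ 0 < gap s c z].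

Lemma middle_above S c D : arrangement (c |` S) -> trapezoid S D -> hit c D ->
  middle_part c D `&` above c = side_part true c D.
Proof.
move=> aS tD hD; apply/seteqP; split=> z.
  move=> [/(hit_inside _ aS tD hD)[Dz cz] [_ hz]]; split=> //; split=> //.
  by rewrite /gap subr_gt0 heightE// insideW.
move=> [Dz [cz]]; rewrite /gap subr_gt0 heightE ?insideW// => hz; split.
  exact/(hit_inside _ aS tD hD).
by split=> //; exact: insideW.
Qed.

Lemma middle_below S c D : arrangement (c |` S) -> trapezoid S D -> hit c D ->
  middle_part c D `&` below c = side_part false c D.
Proof.
move=> aS tD hD; apply/seteqP; split=> z.
  move=> [/(hit_inside _ aS tD hD)[Dz cz] [_ hz]]; split=> //; split=> //.
  by rewrite /gap subr_gt0 heightE// insideW.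
move=> [Dz [cz]]; rewrite /gap subr_gt0 heightE ?insideW// => hz; split.
  exact/(hit_inside _ aS tD hD).
by split=> //; exact: insideW.
Qed.

Lemma open_near (P : set (plane R)) : (forall z, P z -> \forall w \near z, P w) -> open P.
Proof. by move=> nP; rewrite openE => z /nP. Qed.

Lemma near_open (P : set (plane R)) z : open P -> P z -> \forall w \near z, P w.
Proof. by move=> oP Pz; apply: open_nbhs_nbhs. Qed.

Lemma gap_vertical s c x y1 y2 y : 0 < gap s c (x, y1) -> 0 < gap s c (x, y2) ->
  y1 <= y <= y2 -> 0 < gap s c (x, y).
Proof. by rewrite /gap /=; case: s => + + /andP[]; lra. Qed.

Lemma side_point s c D x : open D -> D (x, height c x) -> inside c x ->
  exists y, side_part s c D (x, y).
Proof.
move=> oD Dx cx; have /near_box_ex[e e0 He] := near_open oD Dx.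
exists (if s then height c x + e / 2 else height c x - e / 2); split.
  apply: He => /=; first by rewrite subrr normr0.
  by case: s; rewrite ltr_norml; lra.
by split=> //=; rewrite /gap; case: s => /=; lra.
Qed.

(** The given common point may be an endpoint of [c]; since [D] is open, it can slide along [c] to
    an interior abscissa. *)
Lemma hit_inside_point c D : open D -> hit c D ->
  exists2 x, inside c x & D (x, height c x).
Proof.
move=> oD [w [/pointsP[/andP[lw wr] wh] Dw]].
have : \forall x \near w.1, D (x, height c x).
  have cg : continuous (fun x => (x, height c x) : plane R).
    move=> x; exact: (cvg_pair cvg_id (@continuous_height _ c x)).
  apply: (cg w.1); apply: open_nbhs_nbhs; split=> //.
  by rewrite -wh; case: (w) Dw.
move=> /nbhs_ballP[e /= e0 He]; have lr := xleft_lt_xright c.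
have [wr'|wr'] := ltP w.1 (xright c).
  have [x [h1 h2]] : exists x, w.1 < x < w.1 + e /\ x < xright c.
    have [h|h] := leP (w.1 + e) (xright c); [exists (w.1 + e / 2)|exists ((w.1 + xright c) / 2)];
      by split; try apply/andP; try split; lra.
  exists x; first by apply/andP; split; lra.
  by apply: He; rewrite /ball /= ltr_norml; lra.
have [x [h1 h2]] : exists x, w.1 - e < x < w.1 /\ xleft c < x.
  have [h|h] := leP (xleft c) (w.1 - e); [exists (w.1 - e / 2)|exists ((w.1 + xleft c) / 2)];
    by split; try apply/andP; try split; lra.
exists x; first by apply/andP; split; lra.
by apply: He; rewrite /ball /= ltr_norml; lra.
Qed.

Lemma side_part_neq0 s S c D : arrangement (c |` S) -> trapezoid S D -> hit c D ->
  side_part s c D !=set0.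
Proof.
move=> aS tD hD; have oD : open D.
  by apply: trapezoid_open tD; apply: sub_arrangement aS => d; right.
have [x cx Dx] := hit_inside_point oD hD.
by have [y] := side_point s oD Dx cx; exists (x, y).
Qed.

(** Connectedness rests on [hit_height]: over every common abscissa [c] runs inside the open set
    [D], so [D] has points on both sides of it there. *)
Lemma side_part_trapezoid s S c D : arrangement (c |` S) -> trapezoid S D -> hit c D ->
  exists2 F, trapezoid (c |` S) F & side_part s c D `<=` F.
Proof.
move=> aS' tD hD; have aS : arrangement S by apply: sub_arrangement aS' => d; right.
have oD := trapezoid_open aS tD.
have [z Pz] := side_part_neq0 s aS' tD hD.
apply: (trapezoid_ex Pz).
  move=> w [Dw [cw gw]]; apply: unwalled_add => //; first exact: trapezoid_unwalled Dw.
  by move=> _ wh; move: gw; rewrite /gap wh; case: (s); lra.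
apply: connected_vertically_convex.
- apply: open_near => w [Dw [cw gw]].
  exact: (near_and (near_open oD Dw) (near_and (near_inside cw) (near_gap_pos gw))).
- move=> x y1 y2 y [D1 [c1 g1]] [D2 [c2 g2]] hy; split; last first.
    by split=> //; exact: gap_vertical g1 g2 hy.
  exact: (trapezoid_vconvex aS tD D1 D2 hy).
- move=> u v x [Du [/andP[lu ur] _]] [Dv [/andP[lv vr] _]] hx.
  have [y Dy] := connected_fst (trapezoid_connected tD) Du Dv hx.
  have cx : inside c x by move: hx => /andP[]; rewrite /inside; lra.
  apply: side_point => //.
  by apply: (hit_height aS' tD hD Dy); exact: insideW.
Qed.

(** Used with [Q] describing the half-plane left or right of [c]: nothing of [c] is seen from there,
    so its insertion adds no wall. *)
Lemma half_trapezoid S c D (Q : R -> Prop) : arrangement (c |` S) ->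
  trapezoid S D -> D `&` [set z | Q z.1] !=set0 ->
  open [set z : plane R | Q z.1] ->
  (forall x x1 x2, Q x1 -> Q x2 -> x1 <= x <= x2 -> Q x) ->
  (forall x, Q x -> ~ spans c x) ->
  exists2 F, trapezoid (c |` S) F & D `&` [set z | Q z.1] `<=` F.
Proof.
move=> aS' tD [z Pz] oQ cQ nQ.
have aS : arrangement S by apply: sub_arrangement aS' => d; right.
have oD := trapezoid_open aS tD.
apply: (trapezoid_ex Pz).
  move=> w [Dw Qw]; apply: unwalled_add => //; first exact: trapezoid_unwalled Dw.
    by move=> /nQ.
  by move=> s [_ /nQ].
apply: connected_vertically_convex; first exact: openI.
- move=> x y1 y2 y [D1 Q1] [D2 Q2] hy; split=> //.
  exact: (trapezoid_vconvex aS tD D1 D2 hy).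
- move=> u v x [Du Qu] [Dv Qv] hx.
  have [y Dy] := connected_fst (trapezoid_connected tD) Du Dv hx.
  by exists y; split=> //; exact: cQ hx.
Qed.

Lemma open_abscissa_lt (a : R) : open [set z : plane R | z.1 < a].
Proof.
apply: open_near => z za; apply: (near_lt (@continuous_abscissa _) _ za).
by move=> ?; exact: cvg_cst.
Qed.

Lemma open_abscissa_gt (a : R) : open [set z : plane R | a < z.1].
Proof.
apply: open_near => z za; apply: (near_lt _ (@continuous_abscissa _) za).
by move=> ?; exact: cvg_cst.
Qed.

Lemma near_abscissa D x y : open D -> D (x, y) ->
  exists2 e, 0 < e & forall x', `|x - x'| < e -> D (x', y).
Proof.
move=> oD Dx; have /near_box_ex[e e0 He] := near_open oD Dx.
by exists e => // x' h; apply: He => //=; rewrite subrr normr0.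
Qed.

Lemma left_part_neq0 S c D : arrangement S -> trapezoid S D -> D (lendpoint c) ->
  left_part c D !=set0.
Proof.
move=> aS tD Dl; have [e e0 He] := near_abscissa (trapezoid_open aS tD) Dl.
exists (xleft c - e / 2, ordinate c (xleft c)); split; last by rewrite /=; lra.
by apply: He; rewrite ltr_norml; lra.
Qed.

Lemma right_part_neq0 S c D : arrangement S -> trapezoid S D -> D (rendpoint c) ->
  right_part c D !=set0.
Proof.
move=> aS tD Dr; have [e e0 He] := near_abscissa (trapezoid_open aS tD) Dr.
exists (xright c + e / 2, ordinate c (xright c)); split; last by rewrite /=; lra.
by apply: He; rewrite ltr_norml; lra.
Qed.

Lemma left_part_trapezoid S c D : arrangement (c |` S) -> trapezoid S D ->
  D (lendpoint c) -> exists2 F, trapezoid (c |` S) F & left_part c D `<=` F.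
Proof.
move=> aS' tD Dl; have aS : arrangement S by apply: sub_arrangement aS' => d; right.
apply: (@half_trapezoid S c D (fun x => x < xleft c)) => //.
- exact: (left_part_neq0 aS tD Dl).
- exact: open_abscissa_lt.
- by move=> x x1 x2 _ h /andP[_]; lra.
- by move=> x h /andP[]; lra.
Qed.

Lemma right_part_trapezoid S c D : arrangement (c |` S) -> trapezoid S D ->
  D (rendpoint c) -> exists2 F, trapezoid (c |` S) F & right_part c D `<=` F.
Proof.
move=> aS' tD Dr; have aS : arrangement S by apply: sub_arrangement aS' => d; right.
apply: (@half_trapezoid S c D (fun x => xright c < x)) => //.
- exact: (right_part_neq0 aS tD Dr).
- exact: open_abscissa_gt.
- by move=> x x1 x2 h _ /andP[]; lra.
- by move=> x h /andP[]; lra.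
Qed.

(** If [c] were seen first from a point of [D], no curve of [S] would block the vertical segment to
    it, so the segment would stay in [D] and end in a point where [c] hits [D]. *)
Lemma unhit_unfacing s S c D z : arrangement (c |` S) -> ~ S c -> trapezoid S D ->
  ~ hit c D -> D z -> ~ facing s (c |` S) c z.
Proof.
move=> aS' nSc tD nhD Dz [_ cz gc cmin]; apply: nhD.
have zE : z = (z.1, z.2) by case: (z).
exists (z.1, height c z.1); split; first exact: points_height.
have /unwalledP[off fac] := trapezoid_unwalled tD Dz.
rewrite zE in Dz; apply: (trapezoid_slice tD Dz) => e Se ez bet.
have [ge ge'] : 0 < gap s e z /\ gap s e z <= gap s c z.
  have /eqP := off e Se ez; rewrite neq_lt => /orP ne; move: gc bet ne; rewrite /gap.
  by case: (s); case: (leP z.2 (height c z.1)) => ? ? /andP[? ?] [] ?; split; lra.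
have gE : gap s c z = gap s e z by apply/le_anti; rewrite ge' cmin//; right.
have ei : inside e z.1.
  apply: (fac s); split=> // e' Se' e'z ge0; rewrite -gE; apply: cmin => //.
  by right.
apply: (@height_neq _ _ c e z.1 aS' (or_introl erefl) (or_intror Se) _ cz ei).
  by move=> ce; apply: nSc; rewrite ce.
by apply/(gap_eq s).
Qed.

(** No wall enters [D], because [c] is not faced from it. Nor does [D] grow: an old wall vanishes
    only where [c] is faced, and then all nearby points face [c], so none of them is in [D]. *)
Lemma trapezoid_unhit S c D : arrangement (c |` S) -> trapezoid S D -> ~ hit c D ->
  trapezoid (c |` S) D.
Proof.
move=> aS' tD nhD; have aS : arrangement S by apply: sub_arrangement aS' => d; right.
have fS : finite_set S by case: aS.
have [Sc|nSc] := pselect (S c).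
  suff -> : c |` S = S by [].
  by apply/seteqP; split=> [d [->|]|d Sd] //; right.
have unf s w Dw := @unhit_unfacing s S c D w aS' nSc tD nhD Dw.
have DF : D `<=` unwalled (c |` S).
  move=> w Dw; apply: unwalled_add; first exact: trapezoid_unwalled Dw.
    by move=> cw wh; apply: nhD; exists w; split=> //; apply/pointsP.
  by move=> s /unf -/(_ Dw).
have [z Dz] := trapezoid_neq0 tD; exists z; first exact: DF.
apply/seteqP; split.
  by apply: connected_component_max => //; exact: trapezoid_connected tD.
move=> w Fw.
have FF := @connected_component_sub _ (unwalled (c |` S)) z.
apply: (@connected_locally_constant _ (connected_component (unwalled (c |` S)) z) D z) => //.
- exact: component_connected.
- move=> u _ Du; have := near_open (trapezoid_open aS tD) Du.
  by apply: filterS.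
- move=> u Fu nDu.
  have [Su|nSu] := pselect (unwalled S u).
    have tu : trapezoid S (connected_component (unwalled S) u) by exists u.
    have uu : connected_component (unwalled S) u u by exact: connected_component_refl.
    have := near_open (trapezoid_open aS tu) uu.
    apply: filterS => v uv _ Dv; apply: nDu.
    by rewrite (trapezoid_eq tD tu Dv uv).
  have [s fs] : exists s, facing s (c |` S) c u.
    apply: contrapT => nfs; apply: nSu; apply: (unwalled_sub fS (FF _ Fu)) => s fs.
    by apply: nfs; exists s.
  have := near_facing aS' (FF _ Fu) fs.
  by apply: filterS => v [fv _] _ Dv; apply: (unf s v Dv).
- exact: connected_component_refl (DF _ Dz).
Qed.

End Insertion.

(** * Walks in the history DAG *)

Section History.
Variable R : realType.
Implicit Types (c d e : curve R) (S : set (curve R)) (D F : set (plane R)).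
Implicit Types (q z w p : plane R) (G : dag R) (n m v : node R) (s : side).
Implicit Types (dir : node R -> side -> Prop) (E : node R -> node R -> Prop).

(** With [directs q] for [dir] the walks are searches, with the constant [True] they are arbitrary
    paths; depth and query length share the lemmas below. *)
Definition step dir G n m := exists2 s, dag_edge G n s m & dir n s.

Definition label n := match n with
  | Leaf D => D | PointNode D _ => D | CurveNode D _ => D end.

Definition fits S n := match n with
  | Leaf D => trapezoid S D
  | PointNode D _ | CurveNode D _ => D `&` skeleton S !=set0 end.

Definition side_of n s := match n, s with
  | PointNode _ _, (ToLeft | ToRight) => True
  | CurveNode _ _, (ToAbove | ToBelow) => True
  | _, _ => False end.

(* The labels of the inner nodes meet the skeleton, those of the leaves avoid
   it; this tells the old nodes from those created by the next insertion. *)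
Definition well_formed S G :=
  [/\ fits S (dag_root G),
      forall n s m, dag_edge G n s m -> [/\ fits S n, side_of n s & fits S m] &
      forall n s m m', dag_edge G n s m -> dag_edge G n s m' -> m = m'].

Lemma walk_cat E n k m l v : walk E n k m -> walk E m l v -> walk E n (k + l) v.
Proof. by elim=> // a b j x Eab _ IH /IH; apply: walk_cons. Qed.

Lemma walk1 E n m : E n m -> walk E n 1 m.
Proof. by move=> nm; apply: walk_cons nm (walk_nil _ _). Qed.

Lemma walk_mono E E' n k m : (forall a b, E a b -> E' a b) ->
  walk E n k m -> walk E' n k m.
Proof.
move=> EE; elim=> [a|a b j x /EE ab _]; first exact: walk_nil.
exact: walk_cons.
Qed.

Lemma walk_leaf E D k n : (forall m, ~ E (Leaf D) m) -> walk E (Leaf D) k n ->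
  k = 0%N /\ n = Leaf D.
Proof. by move=> nE W; inversion W as [|a b j x ab]; subst; last case: (nE b). Qed.

Lemma walk_inner E n k F : (forall D, n <> Leaf D) -> walk E n k (Leaf F) ->
  exists m k', [/\ k = k'.+1, E n m & walk E m k' (Leaf F)].
Proof.
move=> nl W; inversion W as [a|a b j x ab bx]; subst; first by case: (nl F).
by exists b, j.
Qed.

Lemma well_formed_leaf S G D s m : well_formed S G -> ~ dag_edge G (Leaf D) s m.
Proof. by move=> [_ h _] /h[]. Qed.

Lemma fits_inner S n s : fits S n -> side_of n s -> ~ trapezoid S (label n).
Proof.
case: n => // D p [z [Dz Sz]] _ /trapezoid_unwalled/(_ _ Dz); apply;
  by left.
Qed.

Lemma new_edge_label T c D n s m : new_edge T c D n s m -> label n = D.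
Proof. by case. Qed.

Lemma insert_edge_new S c G n s m : well_formed S G -> trapezoid S (label n) ->
  dag_edge (insert S c G) n s m -> new_edge (trapezoid (c |` S)) c (label n) n s m.
Proof.
move=> [_ h _] tn [[m0 /h[fn sn _]]|[D [tD hD ne]]].
  by case: (fits_inner fn sn tn).
by rewrite (new_edge_label ne).
Qed.

Lemma hit_skeleton S c D : hit c D -> D `&` skeleton (c |` S) !=set0.
Proof. by move=> [z [cz Dz]]; exists z; split=> //; exists c => //; left. Qed.

Lemma fits_entry S c D : hit c D -> fits (c |` S) (entry c D).
Proof.
move=> /(@hit_skeleton S) h; rewrite /entry /entry_right.
by case: ifP => // _; case: ifP.
Qed.

Lemma fits_entry_right S c D : hit c D -> fits (c |` S) (entry_right c D).
Proof. by move=> /(@hit_skeleton S) h; rewrite /entry_right; case: ifP. Qed.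

Lemma fits_replace S c n : arrangement (c |` S) -> fits S n ->
  fits (c |` S) (replace c n).
Proof.
move=> aS; case: n => [D tD|D p [z [Dz [d Sd dz]]]|D d [z [Dz [e Se ez]]]] /=.
- by case: asboolP => hD; [exact: fits_entry|exact: trapezoid_unhit].
- by exists z; split=> //; exists d => //; right.
- by exists z; split=> //; exists e => //; right.
Qed.

Lemma replace_inner c n s : side_of n s -> replace c n = n.
Proof. by case: n. Qed.

Lemma point_nodes_neq c D : PointNode D (lendpoint c) <> PointNode D (rendpoint c).
Proof. by case=> /eqP; rewrite lt_eqF // xleft_lt_xright. Qed.

Lemma new_edge_lendpoint T c D s m :
  new_edge T c D (PointNode D (lendpoint c)) s m ->
  (s = ToRight /\ m = entry_right c D) \/
  exists F, [/\ s = ToLeft, T F, left_part c D `<=` F & m = Leaf F].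
Proof.
move En : (PointNode D (lendpoint c)) => n N.
case: N En => [F Dl tF sF|Dl|Dr|F Dr tF sF|F tF sF|F tF sF] //.
- by right; exists F.
- by left.
- by move=> /point_nodes_neq.
- by move=> /point_nodes_neq.
Qed.

Lemma new_edge_rendpoint T c D s m :
  new_edge T c D (PointNode D (rendpoint c)) s m ->
  (s = ToLeft /\ m = CurveNode D c) \/
  exists F, [/\ s = ToRight, T F, right_part c D `<=` F & m = Leaf F].
Proof.
move En : (PointNode D (rendpoint c)) => n N.
case: N En => [F Dl tF sF|Dl|Dr|F Dr tF sF|F tF sF|F tF sF] //.
- by move=> /esym/point_nodes_neq.
- by move=> /esym/point_nodes_neq.
- by left.
- by right; exists F.
Qed.

Lemma new_edge_functional S c D n s m m' : arrangement (c |` S) ->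
  trapezoid S D -> hit c D -> new_edge (trapezoid (c |` S)) c D n s m ->
  new_edge (trapezoid (c |` S)) c D n s m' -> m = m'.
Proof.
move=> aS' tD hD; have aS : arrangement S by apply: sub_arrangement aS' => d; right.
have := middle_above aS' tD hD; have := middle_below aS' tD hD.
have nlr : xleft c <> xright c.
  by move=> lr; have := xleft_lt_xright c; rewrite lr ltxx.
have unique P F F' : P !=set0 -> trapezoid (c |` S) F -> trapezoid (c |` S) F' ->
    P `<=` F -> P `<=` F' -> F = F'.
  move=> [z Pz] tF tF' PF PF'; exact: trapezoid_eq tF tF' (PF _ Pz) (PF' _ Pz).
move=> Mb Ma; case=> [F Dl tF sF|Dl|Dr|F Dr tF sF|F tF sF|F tF sF] N;
  inversion N; subst => //; try by case: nlr.
- congr Leaf; apply: unique sF _ => //; exact: (left_part_neq0 aS tD Dl).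
- congr Leaf; apply: unique sF _ => //; exact: (right_part_neq0 aS tD Dr).
- congr Leaf; apply: unique sF _ => //; rewrite Ma; exact: (side_part_neq0 _ aS' tD hD).
- congr Leaf; apply: unique sF _ => //; rewrite Mb; exact: (side_part_neq0 _ aS' tD hD).
Qed.

Lemma well_formed_insert S c G : arrangement (c |` S) -> well_formed S G ->
  well_formed (c |` S) (insert S c G).
Proof.
move=> aS wG; have [fr fe ff] := wG; split; first exact: fits_replace.
- move=> n s m [[m0 /fe[fn sn fm] ->]|[D [tD hD]]].
    split=> //; last exact: fits_replace.
    by rewrite -(replace_inner c sn); exact: fits_replace.
  have hs := @hit_skeleton S _ _ hD.
  by case=> [F Dl tF sF|Dl|Dr|F Dr tF sF|F tF sF|F tF sF]; split=> //;
    apply: fits_entry_right.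
- move=> n s m m' E1 E2; have [[D [tD hD N1]]|nn] :=
    pselect (exists D, [/\ trapezoid S D, hit c D &
      new_edge (trapezoid (c |` S)) c D n s m]).
    have Ln := new_edge_label N1; rewrite -Ln in tD.
    have := insert_edge_new wG tD E2; rewrite Ln => N2; rewrite Ln in tD.
    exact: new_edge_functional N1 N2.
  case: E1 => [[m0 e0 ->]|//].
  have [fn sn _] := fe _ _ _ e0.
  case: E2 => [[m1 e1 ->]|[D [tD hD N2]]]; first by rewrite (ff _ _ _ _ e0 e1).
  by have := new_edge_label N2 => LD; case: (fits_inner fn sn); rewrite LD.
Qed.

(** Inner nodes keep their outgoing edges up to replacement of the targets, so a walk in the new DAG
    follows an old walk to an old leaf and continues inside the nodes that replaced it. The start
    has the form [replace c n0] because the induction passes from a node to the replacement of its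
    child. *)
Lemma walk_insert dir S c G n0 k F : arrangement (c |` S) -> well_formed S G ->
  fits S n0 -> walk (step dir (insert S c G)) (replace c n0) k (Leaf F) ->
  exists D k0, [/\ trapezoid S D, walk (step dir G) n0 k0 (Leaf D) &
    (~ hit c D /\ F = D /\ k = k0) \/
    (hit c D /\ exists2 k1, k = (k0 + k1)%N &
       walk (step dir (insert S c G)) (entry c D) k1 (Leaf F))].
Proof.
move=> aS wG; have wG' := well_formed_insert aS wG; have [_ fe _] := wG.
have leafcase D k' : trapezoid S D ->
    walk (step dir (insert S c G)) (replace c (Leaf D)) k' (Leaf F) ->
    exists D' k0, [/\ trapezoid S D', walk (step dir G) (Leaf D) k0 (Leaf D') &
      (~ hit c D' /\ F = D' /\ k' = k0) \/
      (hit c D' /\ exists2 k1, k' = (k0 + k1)%N &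
       walk (step dir (insert S c G)) (entry c D') k1 (Leaf F))].
  move=> tD W; exists D, 0%N; split=> //; first exact: walk_nil.
  move: W; rewrite /=; case: asboolP => hD W; [right|left].
    by split=> //; exists k'.
  by have [|-> [->]] := walk_leaf _ W; [move=> m [s /(well_formed_leaf wG')]|].
elim: k n0 => [|k IH] n0 fn0 W.
  case: n0 fn0 W => [D tD|D p _ W|D p _ W]; first exact: leafcase.
    by inversion W.
  by inversion W.
case: (n0) (fn0) (W) => [D tD|D p fn W'|D p fn W']; first exact: leafcase.
- have [//|m [k' [[<-] [s [[m0 e0 ->]|[D' [tD' _ N]]] ds] Wm]]] := walk_inner _ W'.
    have [_ _ fm] := fe _ _ _ e0.
    have [D' [k0 [tD' W0 alt]]] := IH m0 fm Wm.
    exists D', k0.+1; split=> //; first by apply: walk_cons W0; exists s.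
    case: alt => [[nh [-> ->]]|[h [k1 -> W1]]]; first by left.
    by right; split=> //; exists k1.
  case: (@fits_inner S _ ToLeft fn I); by rewrite (new_edge_label N).
- have [//|m [k' [[<-] [s [[m0 e0 ->]|[D' [tD' _ N]]] ds] Wm]]] := walk_inner _ W'.
    have [_ _ fm] := fe _ _ _ e0.
    have [D' [k0 [tD' W0 alt]]] := IH m0 fm Wm.
    exists D', k0.+1; split=> //; first by apply: walk_cons W0; exists s.
    case: alt => [[nh [-> ->]]|[h [k1 -> W1]]]; first by left.
    by right; split=> //; exists k1.
  case: (@fits_inner S _ ToAbove fn I); by rewrite (new_edge_label N).
Qed.

Section Insert.
Variables (S : set (curve R)) (c : curve R) (G : dag R) (D : set (plane R)).
Hypotheses (aS : arrangement (c |` S)) (wG : well_formed S G).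
Hypotheses (tD : trapezoid S D) (hD : hit c D).

Let wG' := well_formed_insert aS wG.
Let T := trapezoid (c |` S).

Lemma insert_step dir n m : label n = D ->
  step dir (insert S c G) n m <-> exists2 s, new_edge T c D n s m & dir n s.
Proof.
move=> Ln; split=> [[s e ds]|[s e ds]]; exists s => //.
  by rewrite -Ln; apply: insert_edge_new e => //; rewrite Ln.
by right; exists D.
Qed.

Lemma walk_new_leaf dir k F F' :
  walk (step dir (insert S c G)) (Leaf F') k (Leaf F) -> k = 0%N /\ F = F'.
Proof.
move=> W; have [|-> [->//]] := walk_leaf _ W.
by move=> m' [s' /(well_formed_leaf wG')].
Qed.

Lemma walk_curve_node dir k F :
  walk (step dir (insert S c G)) (CurveNode D c) k (Leaf F) ->
  k = 1%N /\ exists2 s, new_edge T c D (CurveNode D c) s (Leaf F) &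
                        dir (CurveNode D c) s.
Proof.
move=> W; have [//|m [k' [-> /insert_step[]// s N ds Wm]]] := walk_inner _ W.
have [F' mE] : exists F', m = Leaf F' by inversion N; eexists.
rewrite mE in Wm N; have [-> ->] := walk_new_leaf Wm.
by split=> //; exists s.
Qed.

Lemma entry_right_cases : (D (rendpoint c) /\ entry_right c D = PointNode D (rendpoint c))
  \/ (~ D (rendpoint c) /\ entry_right c D = CurveNode D c).
Proof.
rewrite /entry_right; case: ifPn => [/set_mem|/negP h]; [by left|right].
by split=> // Dr; apply: h; rewrite inE.
Qed.

Lemma entry_cases : (D (lendpoint c) /\ entry c D = PointNode D (lendpoint c))
  \/ (~ D (lendpoint c) /\ entry c D = entry_right c D).
Proof.
rewrite /entry; case: ifPn => [/set_mem|/negP h]; [by left|right].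
by split=> // Dr; apply: h; rewrite inE.
Qed.

Lemma walk_entry_right dir k F :
  walk (step dir (insert S c G)) (entry_right c D) k (Leaf F) -> (k <= 2)%N /\
  forall q, dir = directs q -> D q -> (D (lendpoint c) -> xleft c < q.1) -> F q.
Proof.
have curve_case k' : walk (step dir (insert S c G)) (CurveNode D c) k' (Leaf F) ->
    k' = 1%N /\ forall q, dir = directs q -> D q ->
      (D (lendpoint c) -> xleft c < q.1) -> (D (rendpoint c) -> q.1 < xright c) -> F q.
  move=> /walk_curve_node[-> [s N ds]]; split=> // q dirE Dq ql qr.
  by move: ds; rewrite dirE; inversion N as [| | | |F' tF sF|F' tF sF] => /= aq;
    apply: sF; split.
have [[Dr ->]|[nDr ->]] := entry_right_cases; last first.
  by move=> /curve_case[-> h]; split=> // q dirE Dq ql; apply: (h q).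
move=> W; have [//|m [k' [-> /insert_step[]// s N ds Wm]]] := walk_inner _ W.
have [[sE mE]|[F' [sE tF sF mE]]] := new_edge_rendpoint N; rewrite {}sE {}mE {N} in ds Wm.
  have [-> h] := curve_case _ Wm; split=> // q dirE Dq ql; apply: (h q) => // _.
  by move: ds; rewrite dirE.
have [-> ->] := walk_new_leaf Wm; split=> // q dirE Dq ql.
by apply: sF; split=> //; move: ds; rewrite dirE.
Qed.

(** The three counts the two point nodes and the curve node. The equation [dir = directs q] is a
    premise of the second clause only, so that the length bound also covers arbitrary paths. *)
Lemma walk_entry dir k F :
  walk (step dir (insert S c G)) (entry c D) k (Leaf F) -> (k <= 3)%N /\
  forall q, dir = directs q -> D q -> F q.
Proof.
have [[Dl ->]|[nDl ->]] := entry_cases; last first.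
  move=> /walk_entry_right[k2 h]; split; first exact: leq_trans k2 _.
  by move=> q dirE Dq; apply: (h q).
move=> W; have [//|m [k' [-> /insert_step[]// s N ds Wm]]] := walk_inner _ W.
have [[sE mE]|[F' [sE tF sF mE]]] := new_edge_lendpoint N; rewrite {}sE {}mE {N} in ds Wm.
  have [k2 h] := walk_entry_right Wm; split=> // q dirE Dq; apply: (h q) => // _.
  by move: ds; rewrite dirE.
have [-> ->] := walk_new_leaf Wm; split=> // q dirE Dq.
by apply: sF; split=> //; move: ds; rewrite dirE.
Qed.

(** The truth value counts as 0 or 1: the walk has at least two edges when the left endpoint of [c]
    lies in [D]. This is the growth of the depth per step in the staircase. *)
Lemma walk_middle dir (b : bool) F : T F -> side_part b c D `<=` F ->
  (D (lendpoint c) -> dir (PointNode D (lendpoint c)) ToRight) ->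
  (D (rendpoint c) -> dir (PointNode D (rendpoint c)) ToLeft) ->
  dir (CurveNode D c) (if b then ToAbove else ToBelow) ->
  exists2 k, walk (step dir (insert S c G)) (entry c D) k (Leaf F) &
    (`[< D (lendpoint c) >] < k)%N.
Proof.
move=> tF sF dl dr dc.
have Wc : walk (step dir (insert S c G)) (CurveNode D c) 1 (Leaf F).
  apply: walk1; apply/insert_step => //.
  exists (if b then ToAbove else ToBelow) => //.
  case: (b) sF => sF; [apply: new_curve_above|apply: new_curve_below] => //.
    by rewrite (middle_above aS tD hD).
  by rewrite (middle_below aS tD hD).
have [k Wr k0] : exists2 k, walk (step dir (insert S c G)) (entry_right c D) k (Leaf F) & (0 < k)%N.
  have [[Dr ->]|[nDr ->]] := entry_right_cases; last by exists 1%N.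
  exists 2 => //; apply: walk_cons Wc; apply/insert_step => //.
  by exists ToLeft; [exact: new_rpoint_left|exact: dr].
have [[Dl ->]|[nDl ->]] := entry_cases.
  exists k.+1; last by rewrite asboolT.
  apply: walk_cons Wr; apply/insert_step => //.
  by exists ToRight; [exact: new_lpoint_right|exact: dl].
by exists k => //; rewrite asboolF.
Qed.

Lemma search_entry q : D q -> q.1 <> xleft c -> q.1 <> xright c -> ~ points c q ->
  exists k F, [/\ T F, F q &
    walk (step (directs q) (insert S c G)) (entry c D) k (Leaf F)].
Proof.
move=> Dq ql qr ncq.
have [[Dl lq]|hl] := pselect (D (lendpoint c) /\ q.1 < xleft c).
  have [F tF sF] := left_part_trapezoid aS tD Dl.
  exists 1%N, F; split=> //; first by apply: sF; split.
  have [[_ ->]|[nDl _]//] := entry_cases; apply: walk1; apply/insert_step => //.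
  by exists ToLeft => //; apply: new_lpoint_left.
have {}hl : D (lendpoint c) -> xleft c < q.1.
  move=> Dl; rewrite lt_neqAle eq_sym; apply/andP; split; first exact/eqP.
  by rewrite leNgt; apply/negP => lq; apply: hl.
have [[Dr rq]|hr] := pselect (D (rendpoint c) /\ xright c < q.1).
  have [F tF sF] := right_part_trapezoid aS tD Dr.
  have Wr : walk (step (directs q) (insert S c G)) (entry_right c D) 1 (Leaf F).
    have [[_ ->]|[nDr _]//] := entry_right_cases; apply: walk1; apply/insert_step => //.
    by exists ToRight => //; apply: new_rpoint_right.
  have Fq : F q by apply: sF; split.
  have [[Dl eE]|[_ eE]] := entry_cases; last by exists 1%N, F; rewrite eE.
  exists 2, F; split=> //; rewrite eE; apply: walk_cons Wr; apply/insert_step => //.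
  by exists ToRight; [exact: new_lpoint_right|exact: hl].
have {}hr : D (rendpoint c) -> q.1 < xright c.
  move=> Dr; rewrite lt_neqAle; apply/andP; split; first exact/eqP.
  by rewrite leNgt; apply/negP => rq; apply: hr.
have [_ cq] : D q /\ inside c q.1 by apply/(hit_inside _ aS tD hD).
have [b gq] : exists b, 0 < gap b c q.
  by apply: gap_pos_ex => qh; apply: ncq; apply/pointsP; split=> //; exact: insideW.
have [F tF sF] := side_part_trapezoid b aS tD hD.
have [|k W _] := @walk_middle (directs q) b F tF sF hl hr.
  move: gq; case: (b) => /=; rewrite /gap subr_gt0 => gq; split; rewrite -?heightE//;
    exact: insideW.
by exists k, F; split=> //; apply: sF.
Qed.

End Insert.

Lemma walk_insert_old dir S c G n k m : well_formed S G ->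
  walk (step dir G) n k m -> walk (step dir (insert S c G)) (replace c n) k (replace c m).
Proof.
move=> [_ fe _]; elim=> [a|a b j x [s e ds] _]; first exact: walk_nil.
apply: walk_cons; have [_ sa _] := fe _ _ _ e; rewrite (replace_inner c sa).
by exists s => //; left; exists b.
Qed.

End History.

(** * A lower bound on the longest search path *)

Section Admissible.
Variable R : realType.
Implicit Types (c d e : curve R) (S : set (curve R)) (D F : set (plane R)).
Implicit Types (q z w p : plane R) (G : dag R) (v : node R) (s : side).
Implicit Types (dir : node R -> side -> Prop) (cv : nat -> curve R).

Lemma prefix_setS cv i : prefix_set cv i.+1 = cv i |` prefix_set cv i.
Proof. by rewrite /prefix_set IISl image_setU image_set1. Qed.

Lemma sub_prefix_set cv i n : (i <= n)%N -> prefix_set cv i `<=` prefix_set cv n.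
Proof. by move=> le_in _ [j /= ji <-]; exists j => //=; exact: leq_trans le_in. Qed.

Lemma admissible_inj n cv i j : admissible n cv -> (i < n)%N -> (j < n)%N ->
  cv i = cv j -> i = j.
Proof.
move=> [tI _] ni nj eij; apply: (tI i j ni nj).
have lr := xleft_lt_xright (cv i).
pose x := (xleft (cv i) + xright (cv i)) / 2.
have ci : inside (cv i) x by apply/andP; rewrite /x; split; lra.
exists (x, height (cv i) x).
by rewrite -eij setIid; apply/rel_interiorP; split; first exact: ci.
Qed.

Lemma arrangement_prefix n cv i : admissible n cv -> (i <= n)%N ->
  arrangement (prefix_set cv i).
Proof.
move=> [tI gp] le_in; apply: (sub_arrangement (sub_prefix_set (cv:=cv) le_in)).
split=> //; first by apply: finite_image; exact: finite_II.
move=> c d z [a /= na <-] [b /= nb <-] ncd za zb; apply: ncd; congr cv.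
by apply: (tI a b na nb); exists z.
Qed.

Lemma arrangement_insert n cv i : admissible n cv -> (i < n)%N ->
  arrangement (cv i |` prefix_set cv i).
Proof. by rewrite -prefix_setS; exact: arrangement_prefix. Qed.

Lemma well_formed_history n cv i : admissible n cv -> (i <= n)%N ->
  well_formed (prefix_set cv i) (history cv i).
Proof.
move=> adm; elim: i => [_|i IH ni].
  split=> //=; rewrite /prefix_set II0 image_set0.
  have U : unwalled (set0 : set (curve R)) = [set: plane R].
    apply/seteqP; split=> // z _.
    by apply/unwalledP; split=> // s d [].
  exists (0, 0); first by rewrite -/(unwalled _) U.
  rewrite -/(unwalled _) U connected_component_id//; exact: connected_plane.
rewrite prefix_setS; apply: well_formed_insert; last exact: IH (ltnW ni).
exact: arrangement_insert adm ni.
Qed.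

Definition hits cv q i :=
  exists D, [/\ trapezoid (prefix_set cv i) D, D q & hit (cv i) D].

Lemma walk_historyS n cv i dir k F : admissible n cv -> (i < n)%N ->
  walk (step dir (history cv i.+1)) (dag_root (history cv i.+1)) k (Leaf F) ->
  exists D k0, [/\ trapezoid (prefix_set cv i) D,
    walk (step dir (history cv i)) (dag_root (history cv i)) k0 (Leaf D) &
    (F = D /\ k = k0) \/
    [/\ hit (cv i) D, (k <= k0 + 3)%N & forall q, dir = directs q -> D q -> F q]].
Proof.
move=> adm ni W; have aS := arrangement_insert adm ni.
have wG := well_formed_history adm (ltnW ni); have [fr _ _] := wG.
have [D [k0 [tD W0 alt]]] := walk_insert aS wG fr W.
exists D, k0; split=> //; case: alt => [[_ ?]|[hD [k1 kE W1]]]; [by left|right].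
have [k3 h] := walk_entry aS wG tD hD W1.
by split=> //; rewrite kE leq_add2l.
Qed.

Lemma search_leaf n cv q i k D : admissible n cv -> (i <= n)%N ->
  walk (step (directs q) (history cv i)) (dag_root (history cv i)) k (Leaf D) ->
  D q.
Proof.
move=> adm; elim: i k D => [|i IH] k D ni W.
  by have [|_ [->]] := walk_leaf _ W; first by move=> m [s []].
have [D0 [k0 [tD0 W0 alt]]] := walk_historyS adm ni W.
have D0q := IH _ _ (ltnW ni) W0.
by case: alt => [[-> _]//|[_ _]]; apply.
Qed.

(** By [search_leaf] the search stands in the trapezoid that contains [q], and an insertion that
    misses it leaves the search path unchanged. *)
Lemma search_length n cv q i k D : admissible n cv -> (i <= n)%N ->
  walk (step (directs q) (history cv i)) (dag_root (history cv i)) k (Leaf D) ->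
  (k <= 3 * \sum_(j < i) `[< hits cv q j >])%N.
Proof.
move=> adm; elim: i k D => [|i IH] k D ni W.
  by have [|->] := walk_leaf _ W; first by move=> m [s []].
have [D0 [k0 [tD0 W0 alt]]] := walk_historyS adm ni W.
have le_k0 := IH _ _ (ltnW ni) W0.
rewrite big_ord_recr /= mulnDr; case: alt => [[_ ->]|[hD le_k _]].
  exact: leq_trans le_k0 (leq_addr _ _).
rewrite asboolT; last by exists D0; split=> //; exact: (search_leaf adm (ltnW ni) W0).
by apply: leq_trans le_k _; rewrite leq_add2r.
Qed.

Lemma path_length n cv i k D : admissible n cv -> (i <= n)%N ->
  walk (arrow (history cv i)) (dag_root (history cv i)) k (Leaf D) ->
  (k <= 3 * i)%N.
Proof.
move=> adm ni W.
have {W} : walk (step (fun _ _ => True) (history cv i)) (dag_root (history cv i)) k (Leaf D).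
  by apply: walk_mono W => a b [s e]; exists s.
elim: i k D ni => [|i IH] k D ni W.
  by have [|->] := walk_leaf _ W; first by move=> m [s []].
have [D0 [k0 [tD0 W0 alt]]] := walk_historyS adm ni W.
have := IH _ _ (ltnW ni) W0; case: alt => [[_ ->]|[_ + _]]; lia.
Qed.

Lemma search_ex n cv q i : admissible n cv -> (i <= n)%N ->
  (forall j, (j < i)%N ->
     [/\ q.1 <> xleft (cv j), q.1 <> xright (cv j) & ~ points (cv j) q]) ->
  exists k D, [/\ trapezoid (prefix_set cv i) D, D q &
    walk (step (directs q) (history cv i)) (dag_root (history cv i)) k (Leaf D)].
Proof.
move=> adm; elim: i => [_ _|i IH ni gq].
  exists 0%N, setT; split=> //; last exact: walk_nil.
  by have [] := well_formed_history adm (leq0n n).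
have [|k [D [tD Dq W]]] := IH (ltnW ni) _; first by move=> j ji; apply: gq; exact: ltnW.
have aS := arrangement_insert adm ni.
have wG := well_formed_history adm (ltnW ni).
have := walk_insert_old (cv i) wG W; rewrite /= prefix_setS.
case: asboolP => hD W'; last first.
  by exists k, D; split=> //; exact: trapezoid_unhit.
have [ql qr nq] := gq i (ltnSn i).
have [k' [F [tF Fq W1]]] := search_entry aS wG tD hD Dq ql qr nq.
by exists (k + k')%N, F; split=> //; exact: walk_cat W' W1.
Qed.

(** * Generic queries and the number of leaves *)

Lemma finite_set_avoid (A : set R) (a b : R) : finite_set A -> a < b ->
  exists2 x, a < x < b & ~ A x.
Proof.
move=> fA ab; suff [a' [b' [aa' a'b' b'b nA]]] :
    exists a' b', [/\ a <= a', a' < b', b' <= b & forall x, A x -> ~ (a' < x < b')].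
  exists ((a' + b') / 2); first by apply/andP; split; lra.
  by move=> /nA; apply; apply/andP; split; lra.
move: A fA; apply: finite_set_elim => [|x A _ [a' [b' [aa' a'b' b'b nA]]]].
  by exists a, b.
have [/andP[ax xb]|nx] := boolP (a' < x < b').
  exists a', x; split=> //; first by lra.
  by move=> y [->|/nA ny] /andP[]; [lra|move=> h1 h2; apply: ny; lra].
by exists a', b'; split=> // y [->|/nA//]; exact/negP.
Qed.

Lemma finite_set_gap (A : set R) (h : R) : finite_set A ->
  exists2 e, 0 < e & forall a, A a -> a <= h \/ h + e < a.
Proof.
move: A; apply: finite_set_elim => [|x A _ [e e0 He]]; first by exists 1.
have [xh|hx] := leP x h; first by exists e => // a [->|/He]; [left|].
have [h1|h1] := leP e ((x - h) / 2).
  by exists e => // a [->|/He//]; right; lra.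
exists ((x - h) / 2); first lra.
by move=> a [->|/He[|h2]]; [right; lra|left|right; lra].
Qed.

(** The abscissa avoids all endpoints, and the point is raised by less than the distance to the next
    height above. Clamped heights of curves that do not reach over [x] are avoided as well, which is
    harmless since there are finitely many. *)
Lemma query_above S c : finite_set S -> S c -> exists2 q, facing true S c q &
  forall e, S e -> [/\ q.1 <> xleft e, q.1 <> xright e & ~ points e q].
Proof.
move=> fS Sc.
have fE : finite_set ((@xleft R @` S) `|` (@xright R @` S)).
  by rewrite finite_setU; split; exact: finite_image.
have [x cx nx] := finite_set_avoid fE (xleft_lt_xright c).
have [e e0 He] := finite_set_gap (height c x) (finite_image (fun d => height d x) fS).
have {}He d : S d -> height d x <= height c x \/ height c x + e < height d x.
  by move=> Sd; apply: He; exists d.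
exists (x, height c x + e) => [|d Sd].
  split=> //=; first exact: insideW.
    by rewrite /gap /=; lra.
  by move=> d /He Hd _; rewrite /gap /=; lra.
split=> /= [xd|xd|/pointsP[/= _ hd]].
- by apply: nx; left; exists d.
- by apply: nx; right; exists d.
- by have := He d Sd; lra.
Qed.

(** Nodes may be shared, so the targets are split by the side of the first edge: a side determines
    its edge, an inner node has two sides, and a leaf has no outgoing edge. The start [v] varies in
    the induction. *)
Lemma count_leaves (I : finType) S G (A : {set I}) (f : I -> set (plane R)) K v :
  well_formed S G -> {in A &, injective f} ->
  (forall i, i \in A -> exists2 k, (k <= K)%N & walk (arrow G) v k (Leaf (f i))) ->
  (#|A| <= 2 ^ K)%N.
Proof.
move=> wG; have [_ fe ff] := wG.
have nleaf D m : ~ arrow G (Leaf D) m by move=> [s /(well_formed_leaf wG)].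
have small (B : {set I}) D : {in B &, injective f} ->
    (forall i, i \in B -> exists k, walk (arrow G) (Leaf D) k (Leaf (f i))) ->
    (#|B| <= 1)%N.
  move=> fI WB; apply/card_le1_eqP => i j Bi Bj; apply: fI => //.
  have [k /(walk_leaf (@nleaf D))[_ [->]]] := WB i Bi.
  by have [l /(walk_leaf (@nleaf D))[_ [->]]] := WB j Bj.
elim: K A v => [|K IH] A v fI WA.
  have [->|/set0Pn[i Ai]] := eqVneq A finset.set0; first by rewrite cards0.
  have vE : v = Leaf (f i).
    by have [k] := WA i Ai; rewrite leqn0 => /eqP -> W; inversion W.
  apply: (small _ (f i)) => // j Aj; rewrite -vE.
  by have [k _ W] := WA j Aj; exists k.
pose B s := [set i in A | `[< exists2 m, dag_edge G v s m &
  exists2 k, (k <= K)%N & walk (arrow G) m k (Leaf (f i)) >]]%SET.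
have BP s i : i \in B s -> i \in A /\ exists2 m, dag_edge G v s m &
    exists2 k, (k <= K)%N & walk (arrow G) m k (Leaf (f i)).
  by rewrite inE => /andP[Ai /asboolP].
have cardB s : (#|B s| <= 2 ^ K)%N.
  have [->|/set0Pn[i Bi]] := eqVneq (B s) finset.set0; first by rewrite cards0.
  have [_ [m em _]] := BP s i Bi.
  apply: (IH _ m) => [j l /BP[Aj _] /BP[Al _]|j /BP[_ [m' em' W]]]; first exact: fI.
  by rewrite (ff _ _ _ _ em em').
have split_A s1 s2 : (forall D, v <> Leaf D) ->
    (forall s m, dag_edge G v s m -> s = s1 \/ s = s2) -> (#|A| <= 2 ^ K.+1)%N.
  move=> nl sides; rewrite expnS mul2n -addnn.
  apply: (@leq_trans #|B s1 :|: B s2|).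
    apply: subset_leq_card; apply/fintype.subsetP => i Ai; rewrite inE.
    have [k le_k /(walk_inner nl)[m [k' [kE [s em] W]]]] := WA i Ai.
    have Bi : i \in B s.
      rewrite inE Ai; apply/asboolP; exists m => //; exists k' => //.
      by rewrite -ltnS -kE.
    by apply/orP; case: (sides s m em) => <-; [left|right].
  apply: leq_trans (leq_card_setU _ _) _; exact: leq_add.
case: v {B BP cardB} WA split_A => [D|D p|D c] WA split_A.
- apply: (@leq_trans 1); last by rewrite expn_gt0.
  by apply: (small _ D) => // i /WA[k _]; exists k.
- by apply: (split_A ToLeft ToRight) => // s m /fe[_ + _]; case: s => //=; auto.
- by apply: (split_A ToAbove ToBelow) => // s m /fe[_ + _]; case: s => //=; auto.
Qed.

Lemma search_path_long n cv : admissible n cv -> (0 < n)%N ->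
  exists2 k, search_path_lengths (history cv n) k & (n <= 2 ^ k)%N.
Proof.
move=> adm n0; apply: contrapT => short.
have aS := arrangement_prefix adm (leqnn n); have [fS _ _] := aS.
have Scv (i : 'I_n) : prefix_set cv n (cv i) by exists (nat_of_ord i) => /=.
have leafE (i : 'I_n) : exists F, [/\ trapezoid (prefix_set cv n) F,
    exists2 q, F q & facing true (prefix_set cv n) (cv i) q &
    exists2 k, (k <= trunc_log 2 n.-1)%N &
      walk (arrow (history cv n)) (dag_root (history cv n)) k (Leaf F)].
  have [q fq gq] := query_above fS (Scv i).
  have [|k [F [tF Fq W]]] := search_ex adm (leqnn n) _ (q := q).
    by move=> j jn; apply: gq; exists j.
  exists F; split=> //; first by exists q.
  exists k; last by apply: walk_mono W => a b [s e _]; exists s.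
  have : (2 ^ k < n)%N.
    by rewrite ltnNge; apply/negP => nk; apply: short; exists k => //; exists q, F.
  by move=> kn; apply: trunc_log_max => //; rewrite -ltnS prednK.
have [f fP] := choice leafE.
have f_inj : {in [set: 'I_n]%SET &, injective f}.
  move=> i j _ _ fij; have [tF [q Fq fq] _] := fP i; have [_ [q' Fq' fq'] _] := fP j.
  rewrite -fij in Fq'; have fi := trapezoid_facing aS tF Fq Fq' fq.
  have ii := trapezoid_inside aS tF Fq Fq' fq.
  apply: val_inj; apply: (admissible_inj adm (ltn_ord i) (ltn_ord j)).
  by rewrite (facing_unique aS ii fi fq').
have := count_leaves (well_formed_history adm (leqnn n)) f_inj
  (fun i _ => let: And3 _ _ h := fP i in h).
rewrite cardsT card_ord leqNgt => /negP; apply.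
(* For [n = 1] the logarithm of [n.-1 = 0] is 0 by convention and the count gives no contradiction;
   there any search path suffices. *)
have [n1|n1] := ltnP 1 n.
  have n2 : (0 < n.-1)%N by rewrite -subn1 subn_gt0.
  by apply: leq_ltn_trans (trunc_logP _ n2) _; rewrite // prednK.
have [i] : exists i : 'I_n, True by exists (Ordinal n0).
have [q fq gq] := query_above fS (Scv i).
have [|k [F [tF Fq W]]] := search_ex adm (leqnn n) _ (q := q).
  by move=> j jn; apply: gq; exists j.
case: short; exists k; first by exists q, F.
by apply: leq_trans n1 _; rewrite expn_gt0.
Qed.

Local Open Scope ereal_scope.

Lemma longest_le (X : set nat) (r : R) : (forall k, X k -> k%:R <= r)%R ->
  longest R X <= r%:E.
Proof. by move=> Xr; apply: ge_ereal_sup => _ [k /Xr kr <-]; rewrite lee_fin. Qed.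

Lemma longest_ge (X : set nat) k : X k -> (k%:R)%:E <= longest R X.
Proof. by move=> Xk; apply: ereal_sup_ubound; exists k. Qed.

Lemma search_path_sub G : search_path_lengths G `<=` path_lengths G.
Proof.
move=> k [q [D W]]; exists D; apply: walk_mono W => a b [s e _]; by exists s.
Qed.

Lemma ratio_le (D L : \bar R) (x y : R) : 0 <= D -> D <= x%:E -> (0 < y)%R ->
  y%:E <= L -> D / L <= (x / y)%:E.
Proof.
move=> D0 Dx y0 yL; have x0 : (0 <= x)%R by rewrite -lee_fin; exact: le_trans Dx.
have L0 : 0 <= L by apply: le_trans yL; rewrite lee_fin ltW.
have yV : (y^-1%R)%:E = (y%:E)^-1 by rewrite inver gt_eqF.
rewrite EFinM yV; apply: lee_pmul => //; first by rewrite inve_ge0.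
by rewrite lee_pV2// inE lee_fin ltW.
Qed.

End Admissible.

(** * The staircase example *)

Section Dyadic.
Local Open Scope nat_scope.

(* [dyadic K j], for [0 < j < 2 ^ K], is [2 ^ K] times the [j]-th term of the
   sequence 1/2, 1/4, 3/4, 1/8, 3/8, 5/8, 7/8, 1/16, ... *)
Definition dyadic K j :=
  (2 * (j - 2 ^ trunc_log 2 j) + 1) * 2 ^ (K - (trunc_log 2 j).+1).

Lemma odd_part_inj a a' e e' :
  (2 * a + 1) * 2 ^ e = (2 * a' + 1) * 2 ^ e' -> a = a' /\ e = e'.
Proof.
elim: e e' => [|e IH] [|e']; rewrite ?expnS ?expn0; try lia.
by move=> h; have [|-> ->] := IH e'; first lia.
Qed.

Lemma dyadic_gt0 K j : 0 < dyadic K j.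
Proof. by rewrite muln_gt0 addn1 expn_gt0. Qed.

Lemma dyadic_inj K j j' : 0 < j < 2 ^ K -> 0 < j' < 2 ^ K ->
  dyadic K j = dyadic K j' -> j = j'.
Proof.
move=> /andP[j0 jK] /andP[j0' jK'] /odd_part_inj[ea el].
have /andP[h1 h2] := trunc_log_bounds (isT : 1 < 2) j0.
have /andP[h1' h2'] := trunc_log_bounds (isT : 1 < 2) j0'.
have lK : trunc_log 2 j < K by rewrite -(ltn_exp2l _ _ (isT : 1 < 2)); lia.
have lK' : trunc_log 2 j' < K by rewrite -(ltn_exp2l _ _ (isT : 1 < 2)); lia.
have ll : trunc_log 2 j = trunc_log 2 j' by lia.
by move: ea h1 h1'; rewrite ll; lia.
Qed.

(** An odd [b] is hit by a term of the last level below [2 ^ l]; an even one belongs to the grid of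
    twice the mesh, already covered. *)
Lemma dyadic_cover K l b : l <= K -> 0 < b < 2 ^ l ->
  exists2 j, 0 < j < 2 ^ l & dyadic K j = b * 2 ^ (K - l).
Proof.
elim: l b => [|l IH] b lK hb; first by move: hb; rewrite expn0; lia.
have bE := odd_double_half b; rewrite expnS in hb *.
have eK : 2 ^ (K - l) = 2 * 2 ^ (K - l.+1) by rewrite -expnS; congr (2 ^ _); lia.
case ob : (odd b) bE => bE.
  exists (2 ^ l + b./2); first by have := expn_gt0 2 l; lia.
  have tl : trunc_log 2 (2 ^ l + b./2) = l.
    by apply: trunc_log_eq => //; rewrite expnS; lia.
  by rewrite /dyadic tl addKn; congr (_ * _); lia.
have [||j hj jE] := IH b./2; [lia|lia|].
by exists j; [lia|rewrite jE eK; lia].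
Qed.

End Dyadic.

Section Staircase.
Variable R : realType.
Variable N : nat.
Implicit Types (D F : set (plane R)) (q z w : plane R).

Let lam := trunc_log 2 N.
(* The [i]-th curve is a horizontal segment at height [i]. The first [N] curves
   are short and come in an order that keeps search paths logarithmic; the
   others form a staircase, each step starting above the end of the previous
   one, so that the new trapezoid above a step is cut by the next step. *)
Definition lft i := if (i < N)%N then (4 * dyadic lam.+1 i.+1)%N
                    else (4 * (i - N) + 2)%N.
Definition rgt i := if (i < N)%N then (4 * dyadic lam.+1 i.+1 + 1)%N
                    else (4 * (i - N) + 7)%N.

Lemma lft_lt_rgt i : (lft i)%:R < (rgt i)%:R :> R.
Proof. by rewrite ltr_nat /lft /rgt; case: ifP; lia. Qed.

Lemma continuous_flat (a b y : R) : {within `[a, b], continuous (fun _ : R => y)}.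
Proof. by apply: continuous_subspaceT => x; exact: cvg_cst. Qed.

Definition stair i : curve R :=
  Curve (lft_lt_rgt i) (@continuous_flat _ _ i%:R).

Lemma height_stair i x : height (stair i) x = i%:R.
Proof. by []. Qed.

Lemma N_lt : (N < 2 ^ lam.+1)%N.
Proof. exact: trunc_log_ltn. Qed.

(** Modulo 4 the ends of short segments are 0 and 1, those of steps 2 and 3, so only endpoints of
    the same kind could share an abscissa. *)
Lemma lft_inj i j : lft i = lft j -> i = j.
Proof.
rewrite /lft; have := N_lt; case: ifP => iN; case: ifP => jN NL; try lia.
by move=> h; have := @dyadic_inj lam.+1 i.+1 j.+1; lia.
Qed.

Lemma rgt_inj i j : rgt i = rgt j -> i = j.
Proof.
rewrite /rgt; have := N_lt; case: ifP => iN; case: ifP => jN NL; try lia.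
by move=> h; have := @dyadic_inj lam.+1 i.+1 j.+1; lia.
Qed.

Lemma lft_neq_rgt i j : lft i <> rgt j.
Proof. by rewrite /lft /rgt; case: ifP; case: ifP; lia. Qed.

Lemma admissible_stair n : admissible n stair.
Proof.
split=> [i j _ _ [z [/rel_interiorP[_ zi] /rel_interiorP[_ zj]]]|].
  by apply/eqP; rewrite -(eqr_nat R) -(height_stair i z.1) -zi zj.
split=> [p q [_ [i _ <-] pi] [_ [j _ <-] qj] pq|p _ [_ [i _ <-] pi] [j _ <-]].
  have natE a b : a%:R = b%:R :> R -> a = b by move=> /eqP; rewrite eqr_nat => /eqP.
  case: pi qj pq => -> [] -> /= /natE.
  - by move=> /lft_inj ->.
  - by move=> /lft_neq_rgt.
  - by move=> /esym/lft_neq_rgt.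
  - by move=> /rgt_inj ->.
move=> /rel_interiorP[jp ph]; have ij : i = j.
  by apply/eqP; rewrite -(eqr_nat R) -(height_stair j p.1) -ph; case: pi => ->.
by move: pi jp; rewrite ij /inside => -[] -> /=; rewrite ltxx ?andbF.
Qed.

(** * Searches and paths in the staircase history *)

Variable M : nat.
Hypothesis MN : (M <= N)%N.
Hypothesis M0 : (0 < M)%N.

Let n := (N + M)%N.
Let adm := admissible_stair n.

(** Looking from [z] towards the [j]-th curve, the curve seen first has the integer [lft j] in its
    interior. A short segment joins consecutive integers, so it is a step that is seen, and the
    whole trapezoid faces it. *)
Lemma barrier i j D z : (i <= n)%N -> (j < i)%N ->
  trapezoid (prefix_set stair i) D -> D z -> z.1 = (lft j)%:R ->
  exists2 k, (N <= k < i)%N & forall w, D w -> inside (stair k) w.1.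
Proof.
move=> ni ji tD Dz zE; have aS := arrangement_prefix adm ni; have [fS _ _] := aS.
have Sj : prefix_set stair i (stair j) by exists j.
have jz : spans (stair j) z.1.
  by rewrite /spans zE /= lexx ltW // lft_lt_rgt.
have /unwalledP[/(_ _ Sj jz) zj _] := trapezoid_unwalled tD Dz.
have [s gs] := gap_pos_ex zj; have [d fd _] := facing_ex fS Sj jz gs.
have [[k /= ki kd] _ _ _] := fd; rewrite -{}kd in fd.
exists k => [|w Dw]; last exact: trapezoid_inside aS tD Dz Dw fd.
rewrite ki andbT leqNgt; apply/negP => kN.
have := trapezoid_inside aS tD Dz Dz fd; rewrite /inside zE /= !ltr_nat /rgt /lft kN.
by case: ifP; lia.
Qed.

Lemma side_lt D w q (x : R) : connected D -> (forall z, D z -> z.1 <> x) ->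
  D w -> D q -> w.1 < x -> q.1 < x.
Proof.
move=> cD nx Dw Dq wx; rewrite ltNge; apply/negP => xq.
have [|y Dy] := @connected_fst _ D w q x cD Dw Dq; first by rewrite (ltW wx).
exact: nx Dy erefl.
Qed.

Lemma side_gt D w q (x : R) : connected D -> (forall z, D z -> z.1 <> x) ->
  D w -> D q -> x < w.1 -> x < q.1.
Proof.
move=> cD nx Dw Dq xw; rewrite ltNge; apply/negP => qx.
have [|y Dy] := @connected_fst _ D q w x cD Dq Dw; first by rewrite qx (ltW xw).
exact: nx Dy erefl.
Qed.

Lemma hitsP q i : (i < n)%N -> hits stair q i -> exists D w,
  [/\ trapezoid (prefix_set stair i) D, D q, D w &
      (lft i)%:R <= w.1 <= (rgt i)%:R].
Proof. by move=> ni [D [tD Dq [w [[wE _] Dw]]]]; exists D, w; split. Qed.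

(** The classes of a pigeonhole count: a query is hit at most once per class. There are [lam.+1]
    levels of short segments and 8 residues of steps. *)
Definition code i :=
  if (i < N)%N then trunc_log 2 i.+1 else (lam.+1 + (i - N) %% 8)%N.

Lemma code_lt i : (i < n)%N -> (code i < lam + 9)%N.
Proof.
rewrite /code; case: ifP => iN _; last by lia.
by have := leq_trunc_log 2 iN; rewrite -/lam; lia.
Qed.

(** Between two terms of one level lies a term of an earlier level. While only short segments are
    present, no trapezoid crosses the vertical line of its left end, so the two hit trapezoids are
    on opposite sides. *)
Lemma short_hits_inj q i i' : (i < i')%N -> (i' < N)%N -> hits stair q i ->
  hits stair q i' -> trunc_log 2 i.+1 <> trunc_log 2 i'.+1.
Proof.
move=> ii' i'N hi hi' ell.
have iN := ltn_trans ii' i'N; have in' : (i' < n)%N by exact: ltn_addr.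
have in0 : (i < n)%N by exact: ltn_addr.
pose l := trunc_log 2 i.+1; pose a := (i.+1 - 2 ^ l)%N.
have /andP[h1 h2] := @trunc_log_bounds 2 i.+1 isT isT.
have /andP[h1' h2'] := @trunc_log_bounds 2 i'.+1 isT isT.
rewrite -ell in h1' h2'; rewrite -/l !expnS in h1 h2 h1' h2'.
have lK : (l < lam.+1)%N by rewrite ltnS; apply: leq_trunc_log; lia.
(* In units of the mesh of this level the two terms are at the odd positions [2 * a + 1] and,
   further right, that of [i']; the separator is at [2 * a + 2]. *)
have [||j0 j0l j0E] := @dyadic_cover lam.+1 l a.+1; [lia|rewrite /a; lia|].
have eK : (2 ^ (lam.+1 - l) = 2 * 2 ^ (lam.+1 - l.+1))%N.
  by rewrite -expnS; congr (2 ^ _)%N; lia.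
have e0 : (0 < 2 ^ (lam.+1 - l.+1))%N by rewrite expn_gt0.
have lftE : lft j0.-1 = (4 * dyadic lam.+1 j0)%N.
  by rewrite /lft prednK ?ifT //; lia.
have nobar u D z : (u < N)%N -> (i <= u)%N -> trapezoid (prefix_set stair u) D ->
    D z -> z.1 <> (lft j0.-1)%:R.
  move=> uN iu tD Dz zE.
  have [||k] := barrier _ _ tD Dz zE; [by apply: ltnW; exact: ltn_addr|lia|lia].
have dy : dyadic lam.+1 i.+1 = ((2 * a + 1) * 2 ^ (lam.+1 - l.+1))%N by [].
have dy' : dyadic lam.+1 i'.+1 =
    ((2 * (i'.+1 - 2 ^ l) + 1) * 2 ^ (lam.+1 - l.+1))%N.
  by rewrite /dyadic -ell.
have [D [w [tD Dq Dw /andP[_ wr]]]] := hitsP in0 hi.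
have [D' [w' [tD' Dq' Dw' /andP[wl' _]]]] := hitsP in' hi'.
have q1 : q.1 < (lft j0.-1)%:R.
  apply: (side_lt (trapezoid_connected tD) _ Dw Dq).
    by move=> z; exact: nobar tD.
  apply: le_lt_trans wr _; rewrite ltr_nat lftE j0E /rgt iN dy eK.
  move: e0; set e := (2 ^ _)%N; clear; nia.
have q2 : (lft j0.-1)%:R < q.1.
  apply: (side_gt (trapezoid_connected tD') _ Dw' Dq').
    by move=> z; apply: nobar tD' => //; exact: ltnW.
  apply: lt_le_trans wl'; rewrite ltr_nat lftE j0E {1}/lft i'N dy' eK.
  have : (a.+1 <= i'.+1 - 2 ^ l)%N by rewrite /a; lia.
  move: e0; set e := (2 ^ (_ - _))%N; set a' := (_ - _)%N; clear; nia.
by have := lt_trans q1 q2; rewrite ltxx.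
Qed.

Lemma stair_hits_inj q t t' : (t + 8 <= t')%N -> (t' < M)%N ->
  hits stair q (N + t) -> ~ hits stair q (N + t').
Proof.
move=> tt' t'M hi hi'.
have in' : (N + t' < n)%N by rewrite ltn_add2l.
have in0 : (N + t < n)%N by rewrite ltn_add2l; lia.
(* The separating line at [8 * b] lies between [4 * t + 12] and [4 * t + 19]. The first step ends at
   [4 * t + 7] and the second starts at [4 * t + 34] or later, so a step of length 5 reaches from
   neither of them across the line. *)
pose b := ((4 * t + 19) %/ 8)%N.
have NL := N_lt; rewrite expnS in NL.
(* The last level of short segments may be incomplete, but the terms before [2 ^ lam <= N] all
   exist; their left ends are the multiples of 8. The bound on [b] comes from [M <= N]. *)
have [||j0 j0l j0E] := @dyadic_cover lam.+1 lam b; [lia|rewrite /b; lia|].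
have lamN : (2 ^ lam <= N)%N by apply: trunc_logP => //; lia.
have lftE : lft j0.-1 = (8 * b)%N.
  rewrite /lft prednK ?ifT; [|lia..].
  by rewrite j0E subSn // subnn; lia.
have step_at k : (N <= k)%N -> rgt k = (lft k + 5)%N by rewrite /lft /rgt; case: ifP; lia.
have [D [w [tD Dq Dw /andP[_ wr]]]] := hitsP in0 hi.
have [D' [w' [tD' Dq' Dw' /andP[wl' _]]]] := hitsP in' hi'.
have q1 : q.1 < (lft j0.-1)%:R.
  apply: (side_lt (trapezoid_connected tD) _ Dw Dq).
    move=> z Dz zE.
    have [||k kN kD] := barrier _ _ tD Dz zE; [exact: ltnW|lia|].
    have /andP[_] := kD _ Dz; have /andP[+ _] := kD _ Dw.
    rewrite zE /= => /lt_le_trans/(_ wr); rewrite !ltr_nat step_at; last lia.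
    by rewrite lftE /rgt /b; case: ifP; lia.
  by apply: le_lt_trans wr _; rewrite ltr_nat lftE /rgt /b; case: ifP; lia.
have q2 : (lft j0.-1)%:R < q.1.
  apply: (side_gt (trapezoid_connected tD') _ Dw' Dq').
    move=> z Dz zE.
    have [||k kN kD] := barrier _ _ tD' Dz zE; [exact: ltnW|lia|].
    have /andP[+ _] := kD _ Dz; have /andP[_] := kD _ Dw'.
    rewrite zE /= => /(le_lt_trans wl'); rewrite !ltr_nat step_at; last lia.
    by rewrite lftE {1}/lft /b; case: ifP; lia.
  by apply: lt_le_trans wl'; rewrite ltr_nat lftE /lft /b; case: ifP; lia.
by have := lt_trans q1 q2; rewrite ltxx.
Qed.

Lemma code_inj q i i' : (i < i')%N -> (i' < n)%N -> hits stair q i ->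
  hits stair q i' -> code i <> code i'.
Proof.
move=> ii' in' hi hi'; rewrite /code.
case: (ltnP i N) => iN; case: (ltnP i' N) => i'N.
- exact: short_hits_inj hi hi'.
- by have := leq_trunc_log 2 iN; rewrite -/lam; lia.
- lia.
- move=> h; apply: (@stair_hits_inj q (i - N) (i' - N)); rewrite ?subnKC//; rewrite /n in in'; lia.
Qed.

Lemma count_hits q : (\sum_(j < n) `[< hits stair q j >] <= lam + 9)%N.
Proof.
pose H : {set 'I_n} := [set j : 'I_n | `[< hits stair q j >]]%SET.
have -> : (\sum_(j < n) `[< hits stair q j >] = #|H|)%N.
  rewrite -sum1_card [RHS]big_mkcond; apply: eq_bigr => j _.
  by rewrite inE; case: asboolP.
pose f (j : 'I_n) : 'I_(lam + 9) := Ordinal (code_lt (ltn_ord j)).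
have fI : {in H &, injective f}.
  move=> i j; rewrite !finset.in_set => /asboolP hi /asboolP hj [eij]; apply/val_inj => /=.
  case: (ltngtP i j) => // ij.
    by case: (code_inj ij (ltn_ord j) hi hj).
  by case: (code_inj ij (ltn_ord i) hj hi).
rewrite -(card_in_imset fI); apply: leq_trans (max_card _) _.
by rewrite card_ord.
Qed.

Lemma stair_search_short k : search_path_lengths (history stair n) k ->
  (k <= 3 * (lam + 9))%N.
Proof.
move=> [q [D W]]; have := search_length adm (leqnn n) W.
by move=> /leq_trans; apply; rewrite leq_mul2l count_hits.
Qed.

(** Heights grow with the index, so over the interior of the latest step nothing is seen above it,
    and it alone is seen below. *)
Lemma above_stair_unwalled t z : inside (stair (N + t)) z.1 ->
  0 < gap true (stair (N + t)) z -> unwalled (prefix_set stair (N + t).+1) z.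
Proof.
move=> iz gz; have z2 : (N + t)%:R < z.2 by move: gz; rewrite /gap subr_gt0.
have le_h j : (j < (N + t).+1)%N -> j%:R <= (N + t)%:R :> R by rewrite ler_nat ltnS.
apply/unwalledP; split=> [_ [j /= /le_h jt <-] _|s _ [[j /= jt <-] jz gj jmin]].
  by rewrite height_stair; lra.
have {}gj : s = true.
  by case: s gj {jmin} => //; have := le_h j jt; rewrite /gap height_stair; lra.
have St : prefix_set stair (N + t).+1 (stair (N + t)) by exists (N + t)%N => /=.
have := jmin _ St (insideW iz); rewrite gj => /(_ gz).
rewrite /gap !height_stair lerD2l lerN2 ler_nat => tj.
by have -> : j = (N + t)%N by lia.
Qed.

(** The invariant follows the leaf that contains the left endpoint of the step to be inserted
    next. *)
Lemma stair_path t : (t <= M)%N -> exists k D,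
  [/\ (2 * t <= k)%N, trapezoid (prefix_set stair (N + t)) D,
      D ((lft (N + t))%:R, (N + t)%:R) &
      walk (step (fun _ _ => True) (history stair (N + t)))
        (dag_root (history stair (N + t))) k (Leaf D)].
Proof.
elim: t => [_|t IH tM].
  (* The left end of the first step is generic with respect to the short segments, so searching for
     it yields the initial path. *)
  have [|j jN|k [D [tD Dq W]]] := @search_ex R n stair ((lft N)%:R, N%:R) N adm.
  - exact: leq_addr.
  - have d0 := dyadic_gt0 lam.+1 j.+1.
    have natE a b : a%:R = b%:R :> R -> a = b.
      by move=> /eqP; rewrite eqr_nat => /eqP.
    split=> /=; [move=> /natE/lft_inj; lia|move=> /natE/lft_neq_rgt//|].
    move=> /pointsP[/andP[/=]]; rewrite !ler_nat /lft /rgt jN ltnn; lia.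
  rewrite addn0; exists k, D; split=> //.
  by apply: walk_mono W => a b [s e _]; exists s.
have [k [D [kt tD Dl W]]] := IH (ltnW tM).
set i := (N + t)%N in tD Dl W *; have ni : (i < n)%N by rewrite ltn_add2l.
have Dlend : D (lendpoint (stair i)) by [].
have hD : hit (stair i) D.
  exists (lendpoint (stair i)); split=> //; rewrite lendpointE.
  by apply: points_height; exact: spans_left.
have aS := arrangement_insert adm ni; have wG := well_formed_history adm (ltnW ni).
have [F tF sF] := side_part_trapezoid true aS tD hD.
have [//|//|//|k1 W1 k1D] := @walk_middle R _ _ (history stair i) D aS wG tD hD
  (fun _ _ => True) true F tF sF.
have W0 := walk_insert_old (stair i) wG W.
rewrite /= asboolT// in W0.
exists (k + k1)%N, F; rewrite addnS -/i prefix_setS; split=> //.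
- by rewrite asboolT // in k1D; lia.
- have [z Pz] := side_part_neq0 true aS tD hD.
  have [_ Qz] := Pz.
  (* The region above step [i] is connected and free of walls, hence contained in [F]. It includes
     the next left end, since [4 * t + 6 < 4 * t + 7]. *)
  apply: (trapezoid_max tF (sF _ Pz)
    (A := [set z | inside (stair i) z.1 /\ 0 < gap true (stair i) z])) => //.
  + by move=> w [iw gw]; rewrite -prefix_setS; exact: above_stair_unwalled.
  + apply: connected_vertically_convex.
    * apply: open_near => w [iw gw].
      exact: (near_and (near_inside iw) (near_gap_pos gw)).
    * move=> x y1 y2 y [ix g1] [_ g2] hy; split=> //; exact: gap_vertical g1 g2 hy.
    * move=> u v x [/andP[lu ur] _] [/andP[lv vr] _] /andP[ux xv].
      exists (i%:R + 1); split; first by apply/andP; split=> /=; lra.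
      by rewrite /gap height_stair /=; lra.
  + split; last by rewrite /gap height_stair /= subr_gt0 ltr_nat.
    by apply/andP; split; rewrite /= ltr_nat /lft /rgt /i; do 2?case: ifP; lia.
- exact: walk_cat W0 W1.
Qed.

End Staircase.

(** * The ratio of depth to query length *)

Section Ratio.
Variable R : realType.
Local Open Scope ereal_scope.

Lemma ratio_ge (D L : \bar R) (x y : R) : (0 <= x)%R -> x%:E <= D -> 0 < L ->
  L <= y%:E -> (x / y)%:E <= D / L.
Proof.
move=> x0 xD L0 Ly; have y0 : (0 < y)%R by rewrite -lte_fin; exact: lt_le_trans Ly.
have yV : (y^-1%R)%:E = (y%:E)^-1 by rewrite inver gt_eqF.
rewrite EFinM yV; apply: lee_pmul; rewrite ?inve_ge0 ?lee_fin ?(ltW y0)//.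
by rewrite lee_pV2// inE /= ?lee_fin ltW.
Qed.

Lemma path_lengths_neq0 n (cv : nat -> curve R) : admissible n cv -> (0 < n)%N ->
  path_lengths (history cv n) !=set0.
Proof.
move=> adm n0; have [k Lk _] := search_path_long adm n0; exists k; exact: search_path_sub.
Qed.

Lemma ln_nat_le n k : (0 < n)%N -> (n <= 2 ^ k)%N -> (ln n%:R <= k%:R :> R)%R.
Proof.
move=> n0 nk; have ln2 : (ln 2 <= 1 :> R)%R.
  by have := @le_ln1Dx R 1; rewrite (_ : 1 + 1 = 2)%R//; apply; lra.
apply: (@le_trans _ _ (ln (2 ^+ k))).
  by rewrite ler_ln ?posrE ?ltr0n ?exprn_gt0// -natrX ler_nat.
by rewrite lnXn// lerMn2r ln2 orbT.
Qed.

Lemma worst_ratio_le n : (2 <= n)%N ->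
  worst_ratio R n <= (3 * (n%:R / ln n%:R))%:E.
Proof.
move=> n2; have n0 : (0 < n)%N by lia.
apply: ge_ereal_sup => _ [cv adm <-].
have [k Lk nk] := search_path_long adm n0.
have k0 : (0 < k)%N by case: k nk {Lk} => //; lia.
have [j Dj] := path_lengths_neq0 adm n0.
apply: (@le_trans _ _ (((3 * n)%:R / k%:R)%:E)).
  apply: ratio_le; last exact: longest_ge Lk.
  - by apply: le_trans (longest_ge R Dj); rewrite lee_fin.
  - apply: longest_le => i [D W]; rewrite ler_nat.
    exact: path_length adm (leqnn n) W.
  - by rewrite ltr0n.
rewrite lee_fin mulrA -natrM ler_pM2l ?ltr0n ?muln_gt0//.
have lnn : (0 < ln n%:R :> R)%R by rewrite ln_gt0// ltr1n.
by rewrite lef_pV2 ?posrE ?ltr0n// ln_nat_le.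
Qed.

(** The ratio is at least [2 * M] over [3 * (trunc_log 2 N + 9)]. Here [n <= 3 * M], with equality
    for [n = 3], and [(trunc_log 2 N + 9) * ln 2 <= 10 * ln n], which gives 45 as
    [3 * 3 * 10 / 2]. *)
Lemma worst_ratio_ge n : (2 <= n)%N ->
  (ln 2 / 45 * (n%:R / ln n%:R))%:E <= worst_ratio R n.
Proof.
move=> n2; pose M := n./2; pose N := (n - M)%N.
have nE := odd_double_half n.
have MN : (M <= N)%N by rewrite /N /M; lia.
have M0 : (0 < M)%N by rewrite /M; lia.
have nNM : n = (N + M)%N by rewrite /N /M; lia.
have adm := admissible_stair R N n.
apply: le_ereal_sup_tmp.
exists (depth (history (stair R N) n) / max_query_length (history (stair R N) n)).
  by exists (stair R N).
have [k [D [Mk _ _ W]]] := stair_path R MN M0 (leqnn M); rewrite -nNM in W.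
have [l Ll nl] := search_path_long adm (ltnW n2).
have l0 : (0 < l)%N by case: l nl {Ll} => //; lia.
pose y := (3 * (trunc_log 2 N + 9))%N.
apply: (@le_trans _ _ (((2 * M)%:R / y%:R)%:E)); last first.
  apply: ratio_ge => //.
  - have Dk : path_lengths (history (stair R N) n) k.
      by exists D; apply: walk_mono W => a b [s e _]; exists s.
    by apply: le_trans (longest_ge R Dk); rewrite lee_fin ler_nat.
  - by apply: lt_le_trans (longest_ge R Ll); rewrite lte_fin ltr0n.
  - apply: longest_le => i; rewrite ler_nat nNM; exact: (stair_search_short MN M0).
have lnn : (0 < ln n%:R :> R)%R by rewrite ln_gt0// ltr1n.
have ln2 : (0 < ln 2 :> R)%R by rewrite ln_gt0// ltr1n.
have ln2n : (ln 2 <= ln n%:R :> R)%R.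
  by rewrite ler_ln ?posrE ?ltr0n ?ler_nat//; lia.
have lamn : ((trunc_log 2 N)%:R * ln 2 <= ln n%:R :> R)%R.
  rewrite mulr_natl -lnXn// ler_ln ?posrE ?exprn_gt0 ?ltr0n//; last lia.
  rewrite -natrX ler_nat; apply: leq_trans (trunc_logP _ _) _ => //; lia.
have y0 : (0 < y%:R :> R)%R by rewrite ltr0n /y; lia.
have Mn : (n%:R <= 3 * M%:R :> R)%R by rewrite -natrM ler_nat /M; lia.
rewrite lee_fin mulrA ler_pdivrMr// [leRHS]mulrAC ler_pdivlMr// /y !natrM natrD.
set A := ln n%:R in lnn ln2n lamn *; set B := ln 2 in ln2 ln2n lamn *.
set l' := (trunc_log 2 N)%:R in lamn *.
have h1 : (n%:R * (B * (l' + 9)) <= n%:R * (10 * A) :> R)%R.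
  by apply: ler_wpM2l => //; lra.
have h2 : (n%:R * A <= 3 * M%:R * A :> R)%R by rewrite ler_pM2r.
lra.
Qed.

End Ratio.

Theorem theorem2 (R : realType) :
  exists a b : R,
    [/\ 0 < a, 0 < b &
        forall n : nat, (2 <= n)%N ->
          ((a * (n%:R / ln n%:R))%:E <= worst_ratio R n)%E /\
          (worst_ratio R n <= (b * (n%:R / ln n%:R))%:E)%E].
Proof.
exists (ln 2 / 45), 3; split=> // [|n n2].
  by rewrite divr_gt0// ln_gt0// ltr1n.
by split; [exact: worst_ratio_ge|exact: worst_ratio_le].
Qed.
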